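(* Fix $N\ge1$ and positive reals $a_1,\dots,a_N$. (Alpha case.) Let $\alpha_1,\alpha_2,\dots$ be positive reals with $a_i\alpha_j<1$ for all $i,j$, and for $1\le k\le n\le N$ and integers $t\ge0$ let $x^{(n)}_k(t)$ be the alpha law-of-large-numbers limits (defined in the context). Set $y^{(n)}_k(t)=e^{-x^{(n)}_k(t)}$ for $1\le k\le n$, $y^{(n)}_k(t)=1$ for $k>n$ and $y^{(n)}_k(t)=0$ for $k\le0$. Then for $1\le k\le n\le N$ and $t\ge1$ (whenever the denominators below do not vanish) $$a_n\,\frac{\Big(1-\frac{y^{(n-1)}_{k-1}(t)}{y^{(n)}_k(t)}\Big)\Big(1-\frac{y^{(n)}_k(t)}{y^{(n)}_{k+1}(t)}\Big)}{1-\frac{y^{(n)}_k(t)}{y^{(n-1)}_k(t)}}=\frac1{\alpha_t}\,\frac{\Big(1-\frac{y^{(n)}_k(t)}{y^{(n)}_k(t-1)}\Big)\Big(1-\frac{y^{(n)}_{k-1}(t)}{y^{(n)}_k(t)}\Big)}{1-\frac{y^{(n)}_{k-1}(t-1)}{y^{(n)}_k(t)}}.$$ (Plancherel case.) For $\tau>0$ let $x^{(n)}_k(\tau)$, $1\le k\le n\le N$, be the Plancherel law-of-large-numbers limits (defined in the context), with the conventions $x^{(n)}_k=0$ for $k>n$ and $x^{(n)}_k=+\infty$ for $k\le0$. Then for $1\le k\le n\le N$ and $\tau>0$ $$\frac{d x^{(n)}_k(\tau)}{d\tau}=a_n\,\frac{\big(1-e^{x^{(n)}_k(\tau)-x^{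(n-1)}_{k-1}(\tau)}\big)\big(1-e^{x^{(n)}_{k+1}(\tau)-x^{(n)}_k(\tau)}\big)}{1-e^{x^{(n-1)}_k(\tau)-x^{(n)}_k(\tau)}}.$$
   Context: The limits $x^{(n)}_k$ are the real numbers determined by the formulas, for $1\le r\le n\le N$, $$e^{-(x^{(n)}_n+\cdots+x^{(n)}_{n-r+1})}=\oint\cdots\oint\frac{(-1)^{\frac{r(r+1)}2}\prod_{1\le k<\ell\le r}(z_k-z_\ell)^2}{(2\pi\mathrm{i})^r\,r!\,\prod_{k=1}^r(z_k)^r}\ \prod_{k=1}^r\bigg(\prod_{\ell=1}^n\frac{a_\ell}{a_\ell-z_k}\bigg)w(z_k)\ dz_1\cdots dz_r,$$ with integration along counterclockwise simple loops enclosing $a_1,\dots,a_n$ but not $0$, where $w(z)=\prod_{i=1}^t(1-\alpha_iz)$ for $x^{(n)}_k=x^{(n)}_k(t)$ (alpha case) and $w(z)=e^{-\tau z}$ for $x^{(n)}_k=x^{(n)}_k(\tau)$ (Plancherel case). *)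

(* Defs.v *)
(* MathComp-Analysis over an abstract [R : realType]; complex numbers are the
   type [R[i]] of mathcomp-real-closed. *)
From HB Require Import structures.
From mathcomp Require Import all_boot all_order all_algebra.
From mathcomp Require Import all_classical all_reals all_analysis.
From mathcomp Require Import complex.

Set Implicit Arguments.
Unset Strict Implicit.
Unset Printing Implicit Defensive.

Import Order.TTheory GRing.Theory Num.Theory.
Import numFieldNormedType.Exports.

Local Open Scope classical_set_scope.
Local Open Scope ring_scope.
Local Open Scope complex_scope.

Section contour.
Context {R : realType}.
Implicit Types (g : R -> R[i]) (f : R[i] -> R[i]).

Definition cexp (z : R[i]) : R[i] :=
  expR (complex.Re z) * cos (complex.Im z)
  +i* (expR (complex.Re z) * sin (complex.Im z)).

Definition re_path g (s : R) : R := complex.Re (g s).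
Definition im_path g (s : R) : R := complex.Im (g s).

Definition path_deriv g (s : R) : R[i] :=
  derive1 (re_path g) s +i* derive1 (im_path g) s.

Definition C1_path g : Prop :=
  [/\ forall s : R, derivable (re_path g) s 1,
      forall s : R, derivable (im_path g) s 1,
      continuous (derive1 (re_path g)) & continuous (derive1 (im_path g))].

(* Loops are parametrized by [0, 1].  The derivative is allowed to vanish, so
   every piecewise C^1 closed curve has such a parametrization (slow down at
   the corners); asking for a C^1 function on the whole line is no restriction
   either, since a C^1 function on [0, 1] extends. *)
Definition simple_loop g : Prop :=
  [/\ C1_path g, g 0 = g 1 &
      forall s t : R, 0 <= s < 1 -> 0 <= t < 1 -> g s = g t -> s = t].

Definition oint g f : R[i] :=
  let h s := f (g s) * path_deriv g s in
  (\int[@lebesgue_measure R]_(s in `[0%R, 1%R]) complex.Re (h s))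
  +i* (\int[@lebesgue_measure R]_(s in `[0%R, 1%R]) complex.Im (h s)).

Definition avoids g (p : R[i]) : Prop := forall s : R, 0 <= s <= 1 -> g s != p.

Definition twopii : R[i] := 0 +i* (2 * pi).

Definition winding g (p : R[i]) : R[i] :=
  twopii^-1 * oint g (fun z => (z - p)^-1).

(* For a simple loop the winding number is 0 around the points outside, and
   around the points inside it is 1 or -1 according to whether the loop runs
   counterclockwise or clockwise. *)
Definition encloses_ccw g (p : R[i]) : Prop := avoids g p /\ winding g p = 1.
Definition not_encloses g (p : R[i]) : Prop := avoids g p /\ winding g p = 0.

Definition admissible_loop (a : nat -> R) (n : nat) g : Prop :=
  [/\ simple_loop g,
      forall l, (1 <= l <= n)%N -> encloses_ccw g (a l)%:C &
      not_encloses g 0].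

Fixpoint iter_oint (gs : seq (R -> R[i])) (F : seq R[i] -> R[i]) : R[i] :=
  if gs is g :: gs' then oint g (fun z => iter_oint gs' (fun zs => F (z :: zs)))
  else F [::].

(* The variables z_1, ..., z_r are zs`_0, ..., zs`_(r-1). *)
Definition lln_integrand (a : nat -> R) (w : R[i] -> R[i]) (n r : nat)
    (zs : seq R[i]) : R[i] :=
  (-1) ^+ (r * r.+1 %/ 2)
  * (\prod_(k < r) \prod_(l < r | (k < l)%N) (zs`_k - zs`_l) ^+ 2)
  / (twopii ^+ r * r`!%:R * \prod_(k < r) zs`_k ^+ r)
  * \prod_(k < r)
      ((\prod_(1 <= l < n.+1) ((a l)%:C / ((a l)%:C - zs`_k))) * w zs`_k).

(* [x n k] is x^(n)_k, for 1 <= k <= n <= N; other values are irrelevant.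
   The integral is the same for all admissible loops, so asking for the formula
   with some choice of loops, possibly different for each n, r and each
   variable, fixes the same numbers as any other reading. *)
Definition lln_limits (N : nat) (a : nat -> R) (w : R[i] -> R[i])
    (x : nat -> nat -> R) : Prop :=
  forall n r, (1 <= r)%N -> (r <= n)%N -> (n <= N)%N ->
  exists gs : nat -> R -> R[i],
    (forall k, (k < r)%N -> admissible_loop a n (gs k)) /\
    (expR (- \sum_((n - r).+1 <= k < n.+1) x n k))%:C
      = iter_oint (mkseq gs r) (lln_integrand a w n r).

Definition w_alpha (alpha : nat -> R) (t : nat) (z : R[i]) : R[i] :=
  \prod_(1 <= i < t.+1) (1 - (alpha i)%:C * z).

Definition w_plancherel (tau : R) (z : R[i]) : R[i] := cexp (- (tau%:C * z)).

(* Boundary conventions; k is only ever at least 0, so k <= 0 means k = 0. *)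
Definition y_of (x : nat -> nat -> R) (n k : nat) : R :=
  if k == 0%N then 0 else if (n < k)%N then 1 else expR (- x n k).

Definition x_ext (x : nat -> nat -> R) (n k : nat) : \bar R :=
  if k == 0%N then +oo%E else if (n < k)%N then 0%E else (x n k)%:E.

(* e^(u - v); it is only used with u finite and v > -oo, where the extended
   exponential is finite, with value 0 for v = +oo. *)
Definition exp_diff (u v : \bar R) : R := fine (expeR (u - v)%E).

End contour.

(* Main.v *)
Require Import Defs.
From HB Require Import structures.
From mathcomp Require Import all_boot all_order all_algebra all_fingroup.
From mathcomp Require Import all_classical all_reals all_analysis.
From mathcomp Require Import complex.
From mathcomp Require Import ring lra zify.

(** The heart of the matter is that all quantities are quotients of Toeplitz
determinants.  Let c_q be minus the integral of
z^q prod_(l <= n) a_l / (a_l - z) w(z) dz / (2 pi i), for q in Z, and put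
T_r(s) = det [c_(s + i - j)], 0 <= i, j < r.

- Up to sign, prod_(k < l) (z_k - z_l)^2 / prod_k z_k^(r - 1) is the product of
  the Vandermonde determinants in the z_k and in the 1 / z_k.  Expanding both
  turns the r-fold integral into D_r = T_r(-1) (lemma [lln_integral]).  Hence
  y_k = D_(n-k+1) / D_(n-k) at level n.  The boundary conventions are part of
  this pattern, because D_(n+1) = 0: the sequence c obeys a linear recurrence of
  order n.

- Passing from level n to level n - 1 replaces c_q by c_q - kappa c_(q+1) with
  kappa = 1 / a_n, and passing from time t - 1 to time t does the same with
  kappa = alpha_t.  Write D', E' for the determinants of the new sequence and
  E_r = T_r(-2), F_r = T_r(0).  Dodgson condensation yields
    D_r D'_(r-1) - D'_r D_(r-1) = kappa F_r E'_(r-1),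
    D_r^2 - D_(r+1) D_(r-1) = E_r F_r,
    D_r D'_r - D_(r+1) D'_(r-1) = F_r E'_r.
  With r = n - k + 1 both sides of the alpha identity become
  F_r E_(r-1) / (D_r D_(r-1)) (lemmas [level_speed] and [time_speed]).

- In the Plancherel case c_q has the derivative - c_(q+1) in tau, which is the
  infinitesimal version of the same replacement; the first relation, divided by
  kappa, gives - (ln (D_r / D_(r-1)))' = F_r E_(r-1) / (D_r D_(r-1)), again the
  value found in [level_speed].

The analytic part shows that the c_q are real, depend on no choice of loop, and
are differentiable in tau.  For w = 1 the c_q are determined by a recursion on
the level, started by integrals that have primitives or are winding numbers;
for w = exp(- tau z) a linear differential equation on each level propagates
the agreement of two loops from tau = 0.

The Plancherel denominators do not vanish because E_r and F_r are positive for
tau > 0 (lemma [flow_tauEF_gt0]).  Since the D_r are exponentials of real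
numbers they are positive; at tau = 0 they equal 1, and a comparison argument
for D_r / D_(r-1) at two consecutive levels propagates strict interlacing. *)

Set Implicit Arguments.
Unset Strict Implicit.
Unset Printing Implicit Defensive.

Import Order.TTheory GRing.Theory Num.Theory.
Import numFieldNormedType.Exports.

Local Open Scope ring_scope.

(** * Condensation of minors *)

(** Arrays indexed by all of nat can be shifted and bordered without casts between
types of matrices. *)
Definition minor (F : comNzRingType) (r : nat) (f : nat -> nat -> F) : F :=
  \det (\matrix_(i < r, j < r) f i j).

Lemma eq_minor (F : comNzRingType) r (f g : nat -> nat -> F) :
  (forall i j, (i < r)%N -> (j < r)%N -> f i j = g i j) -> minor r f = minor r g.
Proof. by move=> fg; congr (\det _); apply/matrixP => i j; rewrite !mxE fg. Qed.

Lemma minor0 (F : comNzRingType) (f : nat -> nat -> F) : minor 0 f = 1.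
Proof. by rewrite /minor det_mx00. Qed.

(** The sign depends on h and r only, so it cancels from identities all of whose
terms are products of two minors. *)
Lemma minor_perm (F : comNzRingType) r (h : nat -> nat) :
  (forall i, (i < r)%N -> (h i < r)%N) ->
  (forall i j, (i < r)%N -> (j < r)%N -> h i = h j -> i = j) ->
  exists b : bool, forall f : nat -> nat -> F,
    minor r (fun i j => f (h i) j) = (-1) ^+ b * minor r f.
Proof.
move=> hr hinj.
pose g (i : 'I_r) : 'I_r := Ordinal (hr i (ltn_ord i)).
have ginj : injective g.
  move=> i j /(congr1 val) /= e; apply: ord_inj; exact: hinj (ltn_ord i) (ltn_ord j) e.
exists (perm ginj : bool) => f.
rewrite /minor -det_perm -det_mulmx -row_permE; congr (\det _).
by apply/matrixP => i j; rewrite !mxE permE.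
Qed.

(** If the rows of K are dependent, every term vanishes.  Otherwise a change of
basis on the columns turns K into (L 0) with L invertible; each bracket is then a
common factor times a 2 x 2 determinant, and what remains is the three-term
relation between four vectors of the plane. *)
Lemma det_col_mx_plucker (F : fieldType) n (K : 'M[F]_(n, n + 2))
    (a b c d : 'rV[F]_(n + 2)) :
  let br (u v : 'rV[F]_(n + 2)) := \det (col_mx K (col_mx u v)) in
  br a b * br c d - br a c * br b d + br a d * br b c = 0.
Proof.
move=> br.
have [Kfree|Kdep] := boolP (row_free K); last first.
  have br0 u v : br u v = 0.
    apply/eqP/det0P.
    have := Kdep; rewrite -kermx_eq0 => /rowV0Pn[w wK w0].
    exists (row_mx w 0).
      by apply: contraNN w0 => /eqP /(congr1 lsubmx); rewrite row_mxKl linear0 => ->.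
    by rewrite mul_row_col (sub_kermxP wK) mul0mx addr0.
  by rewrite !br0 !mul0r subr0 addr0.
(* This P is the change of basis: it clears the last two columns of K. *)
pose P := invmx (row_ebase K).
have Pu : P \in unitmx by rewrite unitmx_inv row_ebase_unit.
have KP : K *m P = row_mx (col_ebase K) 0.
  rewrite -{1}(mulmx_ebase K) -!mulmxA mulmxV ?row_ebase_unit // mulmx1.
  move: Kfree; rewrite /row_free => /eqP ->.
  by rewrite -[pid_mx n]/(pid_mx n : 'M[F]_(n, n + 2)) pid_mx_row mul_mx_row mulmx1
    mulmx0.
have brP u v : br u v * \det P = \det (col_ebase K) *
    \det (col_mx (rsubmx (u *m P)) (rsubmx (v *m P))).
  rewrite -det_mulmx !mul_col_mx KP.
  rewrite -[X in col_mx _ X](_ : row_mx (col_mx (lsubmx (u *m P)) (lsubmx (v *m P)))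
     (col_mx (rsubmx (u *m P)) (rsubmx (v *m P))) = _); last first.
    by rewrite -block_mxEh block_mxEv !hsubmxK.
  by rewrite -block_mxEv det_lblock.
have det2 (x y : 'rV[F]_2) : \det (col_mx x y) = x 0 0 * y 0 1 - x 0 1 * y 0 0.
  rewrite (expand_det_row _ 0) big_ord_recl big_ord1 /cofactor !det_mx11 !mxE /=.
  have sp0 : fintype.split (0 : 'I_(1 + 1)) = inl 0.
    by apply: (canLR (@unsplitK 1 1)); apply/val_inj.
  have sp1 (i : 'I_(1 + 1)) : i != 0 -> fintype.split i = inr 0.
    move=> i0; apply: (canLR (@unsplitK 1 1)); apply/val_inj => /=.
    by case: i i0 => [[|[|k]]].
  have l01 (i : 'I_1) : lift (ord0 : 'I_2) i = 1 by apply/val_inj; rewrite ord1.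
  have l10 : lift (lift (ord0 : 'I_2) ord0) (0 : 'I_1) = 0 by apply/val_inj.
  by rewrite sp0 sp1 // l10 !l01 /= -[ord0]/(0 : 'I_2); ring.
have dP : \det P != 0 by move: Pu; rewrite unitmxE unitfE.
apply: (mulIf dP); apply: (mulIf dP); rewrite (mul0r (\det P)) [RHS]mul0r.
transitivity ((br a b * \det P) * (br c d * \det P)
   - (br a c * \det P) * (br b d * \det P)
   + (br a d * \det P) * (br b c * \det P)); first by ring.
by rewrite !brP !det2; ring.
Qed.

(** The free rows are those that [dodgson] removes, the outer ones.  Moving them
next to each other costs a sign common to all brackets. *)
Lemma plucker_minor (F : fieldType) n (K : nat -> nat -> F) (a b c d : nat -> F) :
  let br u v := minor n.+2 (fun i j => if i == 0%N then u j else
                            if i == n.+1 then v j else K i j) in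
  br a b * br c d - br a c * br b d + br a d * br b c = 0.
Proof.
move=> br.
(* Rows 0, 1, ..., n, n+1 are sent to positions n, 0, ..., n-1, n+1. *)
pose h i := if i == 0%N then n else if i == n.+1 then n.+1 else i.-1.
have hr i : (i < n.+2)%N -> (h i < n.+2)%N by rewrite /h; case: ifP; [|case: ifP]; lia.
have hinj i j : (i < n.+2)%N -> (j < n.+2)%N -> h i = h j -> i = j.
  by rewrite /h; do ![case: ifP => ?]; lia.
have [e he] := @minor_perm F n.+2 h hr hinj.
pose K' : 'M[F]_(n, n + 2) := \matrix_(i, j) K i.+1 j.
pose rw (u : nat -> F) : 'rV[F]_(n + 2) := \row_j u j.
have brE u v : br u v = (-1) ^+ e * \det (col_mx K' (col_mx (rw u) (rw v))).
  pose f i j := if i == n then u j else if i == n.+1 then v j else K i.+1 j.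
  transitivity (minor n.+2 (fun i j => f (h i) j)).
    apply: eq_minor => i j il jl; rewrite /f /h.
    case: i il => [|i] il /=; first by rewrite eqxx.
    rewrite eqSS; have [_|i1] := eqVneq i n; first by rewrite eqxx ifN //; lia.
    by rewrite (negbTE i1) ifN //; lia.
  rewrite he; congr (_ * _); rewrite -[in LHS]addn2; congr (\det _).
  apply/matrixP => i j; rewrite !mxE; case: fintype.splitP => k ik.
    rewrite mxE /f ik; have := ltn_ord k => kn.
    by rewrite ifN ?ifN //; lia.
  rewrite mxE; case: fintype.splitP => l kl; rewrite mxE /f ik kl ord1 /=.
    by rewrite addn0 eqxx.
  by rewrite ifN ?ifT //; lia.
have := det_col_mx_plucker K' (rw a) (rw b) (rw c) (rw d) => /= pl.
rewrite !brE; move: pl.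
set x1 := \det _; set x2 := \det _; set x3 := \det _; set x4 := \det _;
  set x5 := \det _; set x6 := \det _.
move=> pl.
transitivity ((-1) ^+ e * (-1) ^+ e * (x1 * x2 - x3 * x4 + x5 * x6)); first by ring.
by rewrite pl mulr0.
Qed.

Lemma minor_tr (F : comNzRingType) r (f : nat -> nat -> F) :
  minor r f = minor r (fun i j => f j i).
Proof.
by rewrite /minor -det_tr; congr (\det _); apply/matrixP => i j; rewrite !mxE.
Qed.

Lemma minor_unit_row (F : comNzRingType) r (f : nat -> nat -> F) i0 j0 :
  (i0 <= r)%N -> (j0 <= r)%N ->
  (forall j, (j <= r)%N -> f i0 j = (j == j0)%:R) ->
  minor r.+1 f = (-1) ^+ (i0 + j0) * minor r (fun i j => f (bump i0 i) (bump j0 j)).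
Proof.
move=> i0r j0r fE; pose i1 := Ordinal (i0r : (i0 < r.+1)%N).
pose j1 := Ordinal (j0r : (j0 < r.+1)%N).
rewrite /minor (expand_det_row _ i1) (bigD1 j1) //= big1 => [|j jj1]; last first.
  by rewrite mxE fE ?ifN ?mul0r //= ?mul0r -1?ltnS // (negbTE (jj1 : j != j0 :> nat))
    mul0r.
rewrite mxE /= fE // eqxx mul1r addr0 /cofactor; congr (_ * \det _).
by apply/matrixP => i j; rewrite !mxE.
Qed.

Lemma minor_unit_col (F : comNzRingType) r (f : nat -> nat -> F) i0 j0 :
  (i0 <= r)%N -> (j0 <= r)%N ->
  (forall i, (i <= r)%N -> f i j0 = (i == i0)%:R) ->
  minor r.+1 f = (-1) ^+ (i0 + j0) * minor r (fun i j => f (bump i0 i) (bump j0 j)).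
Proof.
move=> i0r j0r fE; rewrite minor_tr (minor_unit_row j0r i0r fE) addnC.
by rewrite minor_tr.
Qed.

Lemma bump_small h k : (k < h)%N -> bump h k = k.
Proof. by move=> kh; rewrite /bump leqNgt kh. Qed.

Lemma bump0 k : bump 0 k = k.+1.
Proof. by []. Qed.

(** Among the first and last rows of f and the first and last unit vectors, the
three-term relation is exactly this: a unit vector used as a row deletes a
column. *)
Lemma dodgson (F : fieldType) n (f : nat -> nat -> F) :
  minor n.+2 f * minor n (fun i j => f i.+1 j.+1) =
  minor n.+1 f * minor n.+1 (fun i j => f i.+1 j.+1) -
  minor n.+1 (fun i j => f i j.+1) * minor n.+1 (fun i j => f i.+1 j).
Proof.
pose br (u v : nat -> F) := minor n.+2 (fun i j => if i == 0%N then u j else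
                            if i == n.+1 then v j else f i j).
pose e0 j : F := (j == 0%N)%:R; pose el j : F := (j == n.+1)%:R.
have pl : br (f 0%N) e0 * br el (f n.+1) - br (f 0%N) el * br e0 (f n.+1)
  + br (f 0%N) (f n.+1) * br e0 el = 0 := plucker_minor n f _ _ _ _.
have b1 : br (f 0%N) (f n.+1) = minor n.+2 f.
  by apply: eq_minor => i j _ _; case: eqP => [->|_] //; case: eqP => [->|].
have b2 : br (f 0%N) el = minor n.+1 f.
  rewrite /br (@minor_unit_row _ _ _ n.+1 n.+1) // => [|j _]; last by rewrite /= eqxx.
  rewrite -signr_odd oddD addbb mul1r; apply: eq_minor => i j il jl.
  rewrite !bump_small // (ltn_eqF il).
  by case: eqP => [->|].
have b3 : br e0 (f n.+1) = minor n.+1 (fun i j => f i.+1 j.+1).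
  rewrite /br (@minor_unit_row _ _ _ 0 0) // mul1r; apply: eq_minor => i j il jl.
  by rewrite !bump0 /= eqSS; case: eqP => [->|].
have b4 : br (f 0%N) e0 = (-1) ^+ n.+1 * minor n.+1 (fun i j => f i j.+1).
  rewrite /br (@minor_unit_row _ _ _ n.+1 0) // => [|j _]; last by rewrite /= eqxx.
  rewrite addn0; congr (_ * _); apply: eq_minor => i j il jl.
  rewrite bump0 bump_small // (ltn_eqF il).
  by case: eqP => [->|].
have b5 : br el (f n.+1) = (-1) ^+ n.+1 * minor n.+1 (fun i j => f i.+1 j).
  rewrite /br (@minor_unit_row _ _ _ 0 n.+1) // add0n; congr (_ * _).
  apply: eq_minor => i j il jl; rewrite bump0 bump_small //= eqSS.
  by case: eqP => [->|].
have b6 : br e0 el = minor n (fun i j => f i.+1 j.+1).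
  rewrite /br (@minor_unit_row _ _ _ 0 0) // mul1r.
  rewrite (@minor_unit_row _ _ _ n n) // => [|j _]; last first.
    by rewrite !bump0 /= eqxx /el eqSS.
  rewrite -signr_odd oddD addbb mul1r; apply: eq_minor => i j il jl.
  by rewrite !bump0 !bump_small //= eqSS (ltn_eqF il).
have ss : (-1) ^+ n.+1 * (-1) ^+ n.+1 = 1 :> F.
  by rewrite -expr2 sqrr_sign.
move: pl; rewrite b1 b2 b3 b4 b5 b6.
set x := minor _ _; set y := minor _ _; set z := minor _ _; set t := minor _ _.
set u := minor _ _; set v := minor _ _.
move=> pl; rewrite [LHS](_ : _ = z * t - ((-1) ^+ n.+1 * (-1) ^+ n.+1) * (x * y)).
  by rewrite ss mul1r.
apply/eqP; rewrite -subr_eq0 -[X in _ == X]pl; apply/eqP; ring.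
Qed.

(** * Toeplitz determinants and their twists *)

(** Subtracting kappa times each column from the next turns the row of powers into
a unit vector.  This exhibits determinants of twisted sequences as minors of a
larger array of untwisted entries, to which condensation applies. *)
Lemma minor_geometric_row (F : comNzRingType) r (f : nat -> nat -> F) kappa i0 :
  (i0 <= r)%N -> (forall j, (j <= r)%N -> f i0 j = kappa ^+ j) ->
  minor r.+1 f = (-1) ^+ i0 *
    minor r (fun i j => f (bump i0 i) j.+1 - kappa * f (bump i0 i) j).
Proof.
move=> i0r fE.
(* Multiplication by U performs the column operations. *)
pose U : 'M[F]_r.+1 := \matrix_(i, j) ((i == j)%:R - (j == i.+1 :> nat)%:R * kappa).
pose g i j := if j is j'.+1 then f i j - kappa * f i j' else f i j.
have detU : \det U = 1.
  rewrite -det_tr det_trig; last first.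
    apply/is_trig_mxP => i j ij; rewrite !mxE.
    have /negbTE -> : j != i by rewrite -val_eqE /=; lia.
    have /negbTE -> : i != j.+1 :> nat by lia.
    by rewrite mul0r subr0.
  rewrite big1 // => i _; rewrite !mxE eqxx.
  have /negbTE -> : i != i.+1 :> nat by lia.
  by rewrite mul0r subr0.
have -> : minor r.+1 f = minor r.+1 g.
  rewrite /minor -[LHS]mulr1 -detU -det_mulmx; congr (\det _).
  apply/matrixP => i j; rewrite !mxE (bigD1 j) //= !mxE eqxx.
  have /negbTE -> : j != j.+1 :> nat by lia.
  rewrite mul0r subr0 mulr1.
  case: j => [[|j] jr] /=.
    rewrite big1 ?addr0 // => k kj; rewrite !mxE (negbTE kj) /=.
    by rewrite mul0r subr0 mulr0.
  pose j' : 'I_r.+1 := Ordinal (ltnW jr).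
  rewrite (bigD1 j') /=; last by rewrite -val_eqE /=; lia.
  rewrite !mxE /= eqxx mul1r big1 => [|k /andP[kj kj']].
    rewrite -val_eqE /=; have /negbTE -> : j != j.+1 by lia.
    rewrite mulr0n; ring.
  rewrite !mxE (negbTE kj) /=; have /negbTE -> : j.+1 != k.+1.
    by move: kj'; rewrite -val_eqE /=; lia.
  by rewrite mul0r subr0 mulr0.
rewrite (@minor_unit_row _ _ _ i0 0) ?addn0 // => -[|j] jr /=.
  by rewrite fE // expr0.
by rewrite !fE ?(ltnW jr) // exprS subrr.
Qed.

Section toeplitz.
Variable F : fieldType.
Implicit Types (c : int -> F) (s : int).

Definition toeplitz c s r := minor r (fun i j => c (s + i%:Z - j%:Z)).

(** Multiplying a weight by 1 - kappa z acts in this way on its moments. *)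
Definition twist kappa c : int -> F := fun q => c q - kappa * c (q + 1).

Lemma toeplitz0 c s : toeplitz c s 0 = 1. Proof. exact: minor0. Qed.

Lemma toeplitz1 c s : toeplitz c s 1 = c s.
Proof. by rewrite /toeplitz /minor det_mx11 mxE /= addr0 subr0. Qed.

(** Deleting an outer row or column of a Toeplitz matrix only shifts the
sequence. *)
Lemma toeplitz_condensation c s m :
  toeplitz c s m.+2 * toeplitz c s m =
  toeplitz c s m.+1 ^+ 2 - toeplitz c (s - 1) m.+1 * toeplitz c (s + 1) m.+1.
Proof.
pose f (i j : nat) := c (s + i%:Z - j%:Z).
have diag k : minor k (fun i j => f i.+1 j.+1) = toeplitz c s k.
  by apply: eq_minor => i j _ _; congr c; lia.
have up : minor m.+1 (fun i j => f i j.+1) = toeplitz c (s - 1) m.+1.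
  by apply: eq_minor => i j _ _; congr c; lia.
have down : minor m.+1 (fun i j => f i.+1 j) = toeplitz c (s + 1) m.+1.
  by apply: eq_minor => i j _ _; congr c; lia.
by have := dodgson m f; rewrite !diag up down expr2.
Qed.

(** Condensation of the Toeplitz matrix with a row of powers of kappa on top: by
[minor_geometric_row] the minors that keep this row are the twisted
determinants. *)
Lemma toeplitz_twist_cross kappa c s m :
  let c' := twist kappa c in
  toeplitz c s m.+1 * toeplitz c' s m - toeplitz c' s m.+1 * toeplitz c s m =
  kappa * toeplitz c (s + 1) m.+1 * toeplitz c' (s - 1) m.
Proof.
move=> c'.
pose f i j := if i == 0%N then kappa ^+ j else c (s + i%:Z - j%:Z).
have top r (g : nat -> nat -> F) t : (forall j, g 0%N j = kappa ^+ j) ->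
    (forall i j, g i.+1 j = c (t + i.+1%:Z - j%:Z)) ->
    minor r.+1 g = toeplitz c' t r.
  move=> g0 g1; rewrite (@minor_geometric_row _ _ _ kappa 0) // mul1r.
  apply: eq_minor => i j _ _; rewrite bump0 !g1 /c' /twist.
  by congr (c _ - _ * c _); lia.
have dg := dodgson m f.
have d1 : minor m.+2 f = toeplitz c' s m.+1 by exact: top.
have d2 : minor m.+1 f = toeplitz c' s m by exact: top.
have d3 : minor m (fun i j => f i.+1 j.+1) = toeplitz c s m.
  by apply: eq_minor => i j _ _; rewrite /f /=; congr c; lia.
have d4 : minor m.+1 (fun i j => f i.+1 j.+1) = toeplitz c s m.+1.
  by apply: eq_minor => i j _ _; rewrite /f /=; congr c; lia.
have d5 : minor m.+1 (fun i j => f i.+1 j) = toeplitz c (s + 1) m.+1.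
  by apply: eq_minor => i j _ _; rewrite /f /=; congr c; lia.
have d6 : minor m.+1 (fun i j => f i j.+1) = kappa * toeplitz c' (s - 1) m.
  pose g i j := if i == 0%N then kappa ^+ j else c (s - 1 + i%:Z - j%:Z).
  rewrite -(top m g (s - 1)) // /minor.
  rewrite (expand_det_row _ 0) [in RHS](expand_det_row _ 0) mulr_sumr.
  apply: eq_bigr => j _; rewrite !mxE /f /g /= exprS -mulrA.
  congr (_ * (_ * (_ * \det _))).
  by apply/matrixP => i k; rewrite !mxE /= /bump /=; congr c; lia.
by rewrite d1 d2 d3 d4 d5 d6 in dg; rewrite dg; ring.
Qed.

(** Here the powers of kappa form the last row, and an additional unit column
deletes the last Toeplitz row from every minor that contains this column.  In this
way determinants whose sizes differ by two meet in one condensation. *)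
Lemma toeplitz_twist_interlace kappa c s m :
  let c' := twist kappa c in
  toeplitz c s m.+1 * toeplitz c' s m.+1 - toeplitz c s m.+2 * toeplitz c' s m =
  toeplitz c (s + 1) m.+1 * toeplitz c' (s - 1) m.+1.
Proof.
move=> c'; pose n := m.+1.
pose f i j := if j is j'.+1 then
    if (i <= n)%N then c (s + i%:Z - j'%:Z) else kappa ^+ j'
  else (i == n)%:R.
have bottom r (g : nat -> nat -> F) t : (forall j, g r j = kappa ^+ j) ->
    (forall i j, (i < r)%N -> g i j = c (t + 1 + i%:Z - j%:Z)) ->
    minor r.+1 g = (-1) ^+ r * toeplitz c' t r.
  move=> g0 g1; rewrite (@minor_geometric_row _ _ _ kappa r) //; congr (_ * _).
  apply: eq_minor => i j il jl; rewrite bump_small // !g1 // /c' /twist.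
  by congr (c _ - _ * c _); lia.
have ss k : (-1) ^+ k * (-1) ^+ k = 1 :> F by rewrite -expr2 sqrr_sign.
have dg := dodgson n f.
have d1 : minor n.+2 f = toeplitz c' (s - 1) n.
  rewrite (@minor_unit_col _ _ _ n 0) ?addn0 //.
  rewrite (bottom n _ (s - 1)) ?mulrA ?ss ?mul1r // => [j|i j il].
    by rewrite bump0 /f /bump leqnn add1n ltnn.
  by rewrite bump0 bump_small // /f (ltnW il); congr c; lia.
have d2 : minor n.+1 f = (-1) ^+ n * toeplitz c s n.
  rewrite (@minor_unit_col _ _ _ n 0) ?addn0 //; congr (_ * _).
  by apply: eq_minor => i j il jl; rewrite bump0 bump_small // /f (ltnW il).
have d3 : minor n (fun i j => f i.+1 j.+1) = toeplitz c (s + 1) n.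
  by apply: eq_minor => i j il _; rewrite /f il; congr c; lia.
have d4 : minor n.+1 (fun i j => f i.+1 j.+1) = (-1) ^+ n * toeplitz c' s n.
  rewrite (bottom n _ s) // => [j|i j il]; rewrite /f ?ltnn // il.
  by congr c; lia.
have d5 : minor n.+1 (fun i j => f i j.+1) = toeplitz c s n.+1.
  by apply: eq_minor => i j il _; rewrite /f -ltnS il.
have d6 : minor n.+1 (fun i j => f i.+1 j) = toeplitz c' s m.
  rewrite (@minor_unit_col _ _ _ m 0) ?addn0 //.
  rewrite (bottom m _ s) ?mulrA ?ss ?mul1r // => [j|i j il].
    by rewrite bump0 /f /bump leqnn add1n ltnn.
  by rewrite bump0 bump_small // /f ltnS (ltnW il); congr c; lia.
rewrite d1 d2 d3 d4 d5 d6 in dg.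
by rewrite [RHS]mulrC dg mulrACA ss mul1r.
Qed.

(** The normalization of q makes the coefficient vector nonzero. *)
Definition recurrent n c := exists2 q : nat -> F, q 0%N = 1 &
  forall p : int, \sum_(j < n.+1) q j * c (p + j%:Z) = 0.

Lemma recurrent_twist n kappa c : recurrent n (twist kappa c) -> recurrent n.+1 c.
Proof.
move=> [q q0 qc].
exists (fun j => (if (j <= n)%N then q j else 0) - (if j is j'.+1 then kappa * q j'
  else 0)).
  by rewrite /= q0 subr0.
move=> p; transitivity (\sum_(j < n.+1) q j * twist kappa c (p + j%:Z)); last exact: qc.
under eq_bigr do rewrite mulrBl; rewrite sumrB.
under [RHS]eq_bigr do rewrite mulrBr; rewrite sumrB; congr (_ - _).
  rewrite big_ord_recr /= ltnn mul0r addr0; apply: eq_bigr => j _.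
  by rewrite -ltnS ltn_ord.
rewrite big_ord_recl /= mul0r add0r; apply: eq_bigr => j _ /=.
by rewrite bump0 mulrCA mulrA; congr (_ * c _); lia.
Qed.

(** The coefficients of the recurrence form a row vector in the kernel of the
matrix. *)
Lemma recurrent_toeplitz0 n c s : recurrent n c -> toeplitz c s n.+1 = 0.
Proof.
move=> [q q0 qc]; apply/eqP/det0P; exists (\row_(i < n.+1) q i).
  apply/negP => /eqP /matrixP /(_ 0 0); rewrite !mxE q0 => /eqP.
  by rewrite oner_eq0.
apply/matrixP => i j; rewrite !mxE -[RHS](qc (s - j%:Z)).
by apply: eq_bigr => k _; rewrite !mxE; congr (_ * c _); lia.
Qed.

(** Untwisting by kappa multiplies the characteristic polynomial of a recurrence
by 1 - kappa X. *)
Lemma recurrent_levels (N : nat) (kappa : nat -> F) (c : nat -> int -> F) :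
  (forall q, c 0%N q = 0) ->
  (forall n, (n < N)%N -> c n = twist (kappa n) (c n.+1)) ->
  forall n, (n <= N)%N -> recurrent n (c n).
Proof.
move=> c0 cS; elim=> [|n IH] nN.
  by exists (fun=> 1) => // p; rewrite big1 // => j _; rewrite c0 mulr0.
by apply: (@recurrent_twist _ (kappa n)); rewrite -cS //; exact/IH/ltnW.
Qed.

End toeplitz.

(** * Derivatives of real functions and of determinants *)

Section real_calculus.
Local Open Scope classical_set_scope.
Variable R : realType.
Implicit Types (f g : R -> R) (x t : R).

Lemma is_derive_mul f g x df dg :
  is_derive x 1 f df -> is_derive x 1 g dg ->
  is_derive x 1 (fun t => f t * g t) (f x * dg + df * g x).
Proof.
move=> hf hg; apply: is_derive_eq (is_deriveM hf hg) _.
by rewrite /GRing.scale /= (mulrC (g x)).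
Qed.

Lemma is_derive_unique f x a b : is_derive x 1 f a -> is_derive x 1 f b -> a = b.
Proof. by move=> [_ <-] [_ <-]. Qed.

Lemma is_derive_within_continuous f f' (a b : R) :
  (forall t, a <= t <= b -> is_derive t 1 f (f' t)) ->
  {within `[a, b], continuous f}.
Proof.
move=> df; apply: derivable_within_continuous => z; rewrite in_itv /= => zab.
exact: (@ex_derive _ _ _ _ _ _ _ (df z zab)).
Qed.

Lemma derive0_const f : (forall t, is_derive t 1 f 0) -> forall x y, f x = f y.
Proof.
move=> df; have lt x y : x < y -> f x = f y.
  move=> xy.
  have fc : {within `[x, y], continuous f}.
    by apply: (is_derive_within_continuous (f' := fun=> 0)) => t _; exact: df.
  have [c _] := @MVT R f (fun=> 0) x y xy (fun t _ => df t) fc.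
  by rewrite mul0r => /eqP; rewrite subr_eq0 => /eqP.
by move=> x y; case: (ltgtP x y) => [/lt|/lt|->].
Qed.

Lemma is_derive_expRM k t :
  is_derive t 1 (fun s => expR (k * s)) (k * expR (k * t)).
Proof.
have dk : is_derive t 1 (fun s : R => k * s) k.
  by apply: is_derive_eq (is_deriveZ k (is_derive_id t 1)) _;
    rewrite /GRing.scale /= mulr1.
have := @is_derive1_comp R expR (fun s => k * s) t _ k (is_derive_expR _) dk.
by rewrite mulrC.
Qed.

Lemma linear_ode_unique f k : (forall t, is_derive t 1 f (k * f t)) -> f 0 = 0 ->
  forall t, f t = 0.
Proof.
move=> df f0 t; pose h t := expR (- k * t) * f t.
have dh (s : R) : is_derive s 1 h 0.
  apply: is_derive_eq (is_derive_mul (is_derive_expRM (- k) s) (df s)) _; ring.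
have := derive0_const dh t 0; rewrite /h f0 mulr0 => /eqP.
by rewrite mulf_eq0 gt_eqF ?expR_gt0 //= => /eqP.
Qed.

(** Were f nonpositive somewhere, it would have a nonpositive minimum at some
d > 0, but a positive derivative at d makes f smaller just before d. *)
Lemma gt0_of_derive f f' :
  (forall t, 0 <= t -> is_derive t 1 f (f' t)) -> f 0 = 0 ->
  (forall t, 0 < t -> f t <= 0 -> 0 < f' t) ->
  forall t, 0 < t -> 0 < f t.
Proof.
move=> df f0 f'gt t t0; rewrite ltNge; apply/negP => ft.
have fc : {within `[0, t], continuous f}.
  by apply: (is_derive_within_continuous (f' := f')) => z /andP[z0 _]; exact: df.
have [c cin cmin] := @EVT_min R f 0 t (ltW t0) fc.
have [d [d0 dt dmin]] : exists d,
    [/\ 0 < d, d <= t & forall s, 0 <= s <= t -> f d <= f s].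
  move: cin; rewrite in_itv /= => /andP[c0 ct].
  have cmin' s : 0 <= s <= t -> f c <= f s by move=> h; apply: cmin; rewrite in_itv.
  move: c0; rewrite le_eqVlt => /predU1P[c0|c0]; last by exists c.
  exists t; split => // s st; apply: le_trans ft _.
  by rewrite -f0 c0; exact: cmin'.
have fd0 : f d <= 0 by rewrite -f0; apply: dmin; rewrite lexx ltW.
have [dfd vd] := df d (ltW d0).
have f'd := f'gt d d0 fd0.
have fcv : (fun h => h^-1 *: ((f \o shift d) (h *: 1) - f d)) @ 0^' --> f' d.
  by rewrite -vd; exact: dfd.
have [e /= e0 he] := cvgr_gt (f' d) fcv 0 f'd.
(* A step to the left that stays in the neighbourhood and in [0, t]. *)
pose h := - (Num.min e d) / 2.
have m0 : 0 < Num.min e d by rewrite lt_min e0 d0.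
have me : Num.min e d <= e by rewrite ge_min lexx.
have md : Num.min e d <= d by rewrite ge_min lexx orbT.
have h0 : h < 0 by rewrite /h; lra.
have := he h; rewrite /ball /= sub0r normrN ltr0_norm // => /(_ _ _).
have -> : - h < e by rewrite /h; lra.
move=> /(_ isT (ltr0_neq0 h0)); rewrite /GRing.scale /= mulr1.
rewrite ltNge => /negP; apply.
apply: mulr_le0_ge0; first by rewrite invr_le0 ltW.
by rewrite subr_ge0; apply: dmin; apply/andP; split; rewrite /h; lra.
Qed.

Lemma minor_expand_row0 (F : comNzRingType) r (f : nat -> nat -> F) :
  minor r.+1 f = \sum_(j < r.+1)
    f 0%N j * ((-1) ^+ j * minor r (fun i k => f i.+1 (bump j k))).
Proof.
rewrite /minor (expand_det_row _ 0); apply: eq_bigr => j _.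
rewrite !mxE /cofactor add0n; congr (_ * (_ * \det _)).
by apply/matrixP => i k; rewrite !mxE.
Qed.

(** What matters is that D sees only the entries and their derivatives at t: two
families that agree to first order have minors that agree to first order. *)
Lemma is_derive_minor r : exists D : (nat -> nat -> R) -> (nat -> nat -> R) -> R,
  forall (f : R -> nat -> nat -> R) (df : nat -> nat -> R) t,
  (forall i j, is_derive t 1 (fun s => f s i j) (df i j)) ->
  is_derive t 1 (fun s => minor r (f s)) (D (f t) df).
Proof.
elim: r => [|r [D hD]].
  exists (fun _ _ => 0) => f df t _.
  rewrite (_ : (fun _ => _) = cst 1); first exact: is_derive_cst.
  by apply/funext => s; rewrite minor0.
exists (fun A B : nat -> nat -> R => \sum_(j < r.+1)
    (A 0%N j * ((-1) ^+ j *
       D (fun i k => A i.+1 (bump j k)) (fun i k => B i.+1 (bump j k)))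
     + B 0%N j * ((-1) ^+ j * minor r (fun i k => A i.+1 (bump j k))))).

move=> f df t fD.
rewrite (_ : (fun _ => _) = \sum_(j < r.+1) (fun s => f s 0%N j * ((-1) ^+ j * minor
  r (fun i k => f s i.+1 (bump j k))))); last first.
  by apply/funext => s; rewrite fct_sumE minor_expand_row0.
apply: is_derive_sum => j; apply: is_derive_mul (fD _ _) _.
Qed.


(** The flow moves the entries to first order as the twist by a small kappa does.
The second assertion is therefore the derivative at kappa = 0 of
[toeplitz_twist_cross]. *)
Lemma is_derive_toeplitz (c : R -> int -> R) s t :
  (forall q, is_derive t 1 (c ^~ q) (- c t (q + 1))) ->
  exists d : nat -> R,
    (forall r, is_derive t 1 (fun u => toeplitz (c u) s r) (d r)) /\
    (forall m, d m.+1 * toeplitz (c t) s m - toeplitz (c t) s m.+1 * d m =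
      - (toeplitz (c t) (s + 1) m.+1 * toeplitz (c t) (s - 1) m)).
Proof.
move=> dc.
(* The twist by kappa has the same first-order entries as the flow. *)
have dtwist (q : int) : is_derive (0 : R) 1 (fun k => twist k (c t) q) (- c t (q + 1)).
  have := is_deriveB (is_derive_cst (c t q) (0 : R) (1 : R))
    (is_derive_mul (is_derive_id (0 : R) 1) (is_derive_cst (c t (q + 1)) (0 : R) (1 :
      R))).
  by move/is_derive_eq; apply; rewrite mul1r mulr0 !add0r.
have exd r : exists d, is_derive t 1 (fun u => toeplitz (c u) s r) d /\
    is_derive (0 : R) 1 (fun k => toeplitz (twist k (c t)) s r) d.
  have [D hD] := is_derive_minor r.
  pose df (i j : nat) := - c t (s + i%:Z - j%:Z + 1).
  exists (D (fun i j => c t (s + i%:Z - j%:Z)) df); split.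
    exact: (hD (fun u i j => c u (s + i%:Z - j%:Z)) df).
  have := hD (fun k i j => twist k (c t) (s + i%:Z - j%:Z)) df 0 (fun i j => dtwist _).
  congr (is_derive _ _ _ (D _ _)).
  by apply/funext => i; apply/funext => j; rewrite /twist mul0r subr0.
have [d dP] := choice exd.
exists d; split => [r|m]; first by have [] := dP r.
have twist0 : twist 0 (c t) = c t by apply/funext => q; rewrite /twist mul0r subr0.
pose T k := toeplitz (twist k (c t)).
have dT r : is_derive (0 : R) 1 (fun k => T k s r) (d r) by have [] := dP r.
have cross : (fun k => toeplitz (c t) s m.+1 * T k s m - T k s m.+1 * toeplitz (c t)
  s m) =
    (fun k => k * (toeplitz (c t) (s + 1) m.+1 * T k (s - 1) m)).
  by apply/funext => k; rewrite /T toeplitz_twist_cross mulrA.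
have [D hD] := is_derive_minor m.
have dG := hD _ (fun (i j : nat) => - c t (s - 1 + i%:Z - j%:Z + 1)) 0 (fun i j =>
  dtwist (s - 1 + i%:Z - j%:Z)).
have dl : is_derive (0 : R) 1
    (fun k => toeplitz (c t) s m.+1 * T k s m - T k s m.+1 * toeplitz (c t) s m) _ :=
  is_deriveB (is_derive_mul (is_derive_cst (toeplitz (c t) s m.+1) (0 : R) (1 : R))
    (dT m))
    (is_derive_mul (dT m.+1) (is_derive_cst (toeplitz (c t) s m) (0 : R) (1 : R))).
have dr : is_derive (0 : R) 1
    (fun k => k * (toeplitz (c t) (s + 1) m.+1 * T k (s - 1) m)) _ :=
  is_derive_mul (is_derive_id (0 : R) 1)
    (is_derive_mul (is_derive_cst (toeplitz (c t) (s + 1) m.+1) (0 : R) (1 : R)) dG).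
rewrite cross in dl; have := is_derive_unique dl dr.
rewrite /= !mul0r mulr0 !add0r addr0 mul1r -/(toeplitz _ _ _) twist0.
by move=> e; rewrite -opprB e.
Qed.

End real_calculus.

(** * The common value of the two sides *)

Section ratios.
Variable F : fieldType.
Implicit Types (c : int -> F) (k : F).

(** The shift - 1 is the one produced by the contour integrals; [tauE] and [tauF]
have the two neighbouring shifts. *)
Definition tauD c r := toeplitz c (-1) r.
Definition tauE c r := toeplitz c (-2) r.
Definition tauF c r := toeplitz c 0 r.

Lemma tau_condensation c m :
  tauD c m.+1 ^+ 2 - tauD c m.+2 * tauD c m = tauE c m.+1 * tauF c m.+1.
Proof. by rewrite /tauD toeplitz_condensation opprB addrC subrK. Qed.

Lemma tau_cross k c m :
  tauD c m.+1 * tauD (twist k c) m - tauD (twist k c) m.+1 * tauD c m =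
  k * tauF c m.+1 * tauE (twist k c) m.
Proof. exact: toeplitz_twist_cross. Qed.

Lemma tau_interlace k c m :
  tauD c m.+1 * tauD (twist k c) m.+1 - tauD c m.+2 * tauD (twist k c) m =
  tauF c m.+1 * tauE (twist k c) m.+1.
Proof. exact: toeplitz_twist_interlace. Qed.

Lemma tau0 c : (tauD c 0 = 1) * (tauE c 0 = 1) * (tauF c 0 = 1).
Proof. by rewrite /tauD /tauE /tauF !toeplitz0. Qed.

(** The value at r = 0 encodes the convention y_k = 1 for k > n. *)
Definition yratio (D : nat -> F) r := if r is r'.+1 then D r / D r' else 1.

(** By the three relations above, each factor on the left is a quotient of products
of determinants, and everything that belongs to the twisted sequence cancels.  For
m = 0 the second factor and the denominator coincide. *)
Lemma level_speed a c m (D := tauD c) (D' := tauD (twist a^-1 c)) :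
  a != 0 -> D m != 0 -> D m.+1 != 0 -> D m.-1 != 0 -> D' m.-1 != 0 -> D' m != 0 ->
  1 - yratio D m.+1 / yratio D' m != 0 ->
  a * ((1 - yratio D' m.+1 / yratio D m.+1) * (1 - yratio D m.+1 / yratio D m) /
       (1 - yratio D m.+1 / yratio D' m)) =
  tauF c m.+1 * tauE c m / (D m.+1 * D m).
Proof.
move=> a0 d0 d1 dm pm p0.
have e1 : 1 - yratio D' m.+1 / yratio D m.+1 =
    a^-1 * tauF c m.+1 * tauE (twist a^-1 c) m / (D m.+1 * D' m).
  by rewrite -tau_cross /= -/(D _) -/(D _) -/(D' _) -/(D' _); field;
    rewrite ?d0 ?d1 ?p0.
rewrite e1.
case: m d0 d1 dm pm p0 {e1} => [|m] d0 d1 dm pm p0 nz.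
  have -> : yratio D 0 = yratio D' 0 by [].
  rewrite mulfK // /D /D' !tau0 !mulr1.
  by field; rewrite a0 d1.
have e2 : 1 - yratio D m.+2 / yratio D m.+1 = tauE c m.+1 * tauF c m.+1 / D m.+1 ^+ 2.
  by rewrite -tau_condensation /= -/(D _) -/(D _) -/(D _); field; rewrite ?d0 ?d1 ?dm.
have e3 : 1 - yratio D m.+2 / yratio D' m.+1 =
   tauF c m.+1 * tauE (twist a^-1 c) m.+1 / (D m.+1 * D' m.+1).
  by rewrite -tau_interlace /= -/(D _) -/(D _) -/(D' _) -/(D' _); field;
    rewrite ?d0 ?pm ?p0 ?dm.
move: nz; rewrite e2 e3 => nz.
have [nf ne] : tauF c m.+1 != 0 /\ tauE (twist a^-1 c) m.+1 != 0.
  by move: nz; rewrite !mulf_eq0 !negb_or => /andP[/andP[]].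
by field; rewrite ?a0 ?nf ?ne ?d0 ?d1 ?p0.
Qed.

(** Same mechanism as in [level_speed], but the result is expressed by the twisted
sequence c; this is why the two speeds agree when c is the sequence at time t. *)
Lemma time_speed alpha c0 m (c := twist alpha c0) (D := tauD c) (D0 := tauD c0) :
  alpha != 0 -> D m != 0 -> D m.+1 != 0 -> D0 m != 0 -> D0 m.+1 != 0 ->
  1 - yratio D0 m.+2 / yratio D m.+1 != 0 ->
  alpha^-1 *
    ((1 - yratio D m.+1 / yratio D0 m.+1) * (1 - yratio D m.+2 / yratio D m.+1) /
       (1 - yratio D0 m.+2 / yratio D m.+1)) =
  tauF c m.+1 * tauE c m / (D m.+1 * D m).
Proof.
move=> a0 d0 d1 p0 p1.
have e1 : 1 - yratio D m.+1 / yratio D0 m.+1 =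
    alpha * tauF c0 m.+1 * tauE c m / (D m * D0 m.+1).
  by rewrite -tau_cross /= -/c -/(D _) -/(D _) -/(D0 _) -/(D0 _); field;
    rewrite ?d0 ?p0 ?p1.
have e2 : 1 - yratio D m.+2 / yratio D m.+1 = tauE c m.+1 * tauF c m.+1 / D m.+1 ^+ 2.
  by rewrite -tau_condensation /= -/(D _) -/(D _) -/(D _); field; rewrite ?d0 ?d1.
have e3 : 1 - yratio D0 m.+2 / yratio D m.+1 =
   tauF c0 m.+1 * tauE c m.+1 / (D0 m.+1 * D m.+1).
  by rewrite -tau_interlace /= -/c -/(D _) -/(D _) -/(D0 _) -/(D0 _); field;
    rewrite ?d0 ?d1 ?p1.
rewrite e1 e2 e3 => nz.
have [nf ne] : tauF c0 m.+1 != 0 /\ tauE c m.+1 != 0.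
  by move: nz; rewrite !mulf_eq0 !negb_or => /andP[/andP[]].
by field; rewrite ?a0 ?nf ?ne ?d0 ?d1 ?p1.
Qed.

End ratios.

(** * Positivity along the flow *)

Section moment_flow.
Local Open Scope classical_set_scope.
Variables (R : realType) (N : nat) (a : nat -> R) (c : nat -> R -> int -> R).
Hypothesis a_gt0 : forall n, (n < N)%N -> 0 < a n.+1.
Hypothesis c_level0 : forall t q, c 0 t q = 0.
Hypothesis c_level : forall n t, (n < N)%N ->
  c n t = twist (a n.+1)^-1 (c n.+1 t).
Hypothesis c_flow : forall n (t : R) q, (n <= N)%N ->
  is_derive t 1 (fun u => c n u q) (- c n t (q + 1)).
Hypothesis c_init : forall n, (n < N)%N -> c n.+1 0 (-1) = 1.

Lemma flow_tauD_top n t : (n <= N)%N -> tauD (c n t) n.+1 = 0.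
Proof.
move=> nN; apply: recurrent_toeplitz0.
apply: (recurrent_levels (N := N) (c := fun m => c m t) (c_level0 t)) nN => m mN.
exact: c_level.
Qed.

(** For the moments of the weight 1 this says that a rational function decaying at
least like z^-2 integrates to 0 around all its poles; the relation between levels
yields it from the value at order - 1. *)
Lemma flow_init_nonneg q n : (q.+1 < n)%N -> (n <= N)%N -> c n 0 q%:Z = 0.
Proof.
elim: q n => [|q IH] [|[|n]] // qn nN; have a0 := gt_eqF (a_gt0 nN).
  have /(congr1 (fun f => f (-1))) := c_level 0 nN.
  rewrite /twist addNr !c_init ?(ltnW nN) //.
  move=> /eqP; rewrite eq_sym -subr_eq0 addrC addKr oppr_eq0 mulf_eq0 invr_eq0 a0 /=.
  by move/eqP.
have /(congr1 (fun f => f q%:Z)) := c_level 0 nN.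
rewrite /twist !IH; [|by lia..].
have -> : q%:Z + 1 = q.+1%:Z by lia.
by rewrite sub0r => /esym/eqP; rewrite oppr_eq0 mulf_eq0 invr_eq0 a0 => /eqP.
Qed.

Lemma flow_tauD_init n r : (r <= n)%N -> (n <= N)%N -> tauD (c n 0) r = 1.
Proof.
move=> rn nN; rewrite /tauD /toeplitz minor_tr /minor det_trig; last first.
  apply/is_trig_mxP => i j ij; rewrite !mxE.
  have -> : -1 + j%:Z - i%:Z = (j - i).-1%:Z by lia.
  by apply: flow_init_nonneg => //; have := ltn_ord j; lia.
rewrite big1 // => i _; rewrite !mxE addrK.
by case: n rn nN => [|n] rn nN; [have := ltn_ord i; lia | exact: c_init].
Qed.

(** The second part of [is_derive_toeplitz] is the numerator of the derivative of
the quotient. *)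
Lemma flow_ratio_derive n m (t : R) : (n <= N)%N -> tauD (c n t) m != 0 ->
  is_derive t 1 (fun u => tauD (c n u) m.+1 / tauD (c n u) m)
   (- (tauF (c n t) m.+1 * tauE (c n t) m) / tauD (c n t) m ^+ 2).
Proof.
move=> nN D0.
have [d [dd e]] := is_derive_toeplitz (-1) (fun q => c_flow t q nN).
have := is_derive_mul (dd m.+1) (is_deriveV D0 (dd m)).
move/is_derive_eq; apply; rewrite /GRing.scale /=.
rewrite -[tauF _ _ * _]/(toeplitz (c n t) (-1 + 1) m.+1 * toeplitz (c n t) (-1 - 1)
  m) -e.
rewrite -/(tauD _ _) -/(tauD _ _).
by field; rewrite D0.
Qed.

Hypothesis D_gt0 : forall n r t, (r <= n)%N -> (n <= N)%N -> 0 < t ->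
  0 < tauD (c n t) r.

Lemma flow_tauD_neq0 n r t : (r <= n)%N -> (n <= N)%N -> 0 <= t ->
  tauD (c n t) r != 0.
Proof.
move=> rn nN; rewrite le_eqVlt => /predU1P[<-|t0].
  by rewrite flow_tauD_init // oner_neq0.
by rewrite gt_eqF // D_gt0.
Qed.

(** Induction on the level, then on the size; D', E', F' denote the determinants
one level below.

For F in the top size, D' vanishes and the cross relation equates F times
positive factors with a product of determinants D.  In smaller sizes let
g = D_(m+1) / D_m - D'_(m+1) / D'_m, which has the sign of F_(m+1) by the cross
relation and vanishes at time 0.  Its derivative
- F_(m+1) E_m / D_m^2 + F'_(m+1) E'_m / D'_m^2 is positive as soon as F_(m+1) is
nonpositive, so g > 0.

For E, the interlacing and cross relations say
D_(m+2) / D_(m+1) < D'_(m+1) / D'_m < D_(m+1) / D_m, that is, E F > 0. *)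
Lemma flow_tauEF_gt0 n r t : (r <= n)%N -> (n <= N)%N -> 0 < t ->
  0 < tauF (c n t) r /\ 0 < tauE (c n t) r.
Proof.
elim: n r t => [|n IHn] r t.
  by case: r => // _ _ _; rewrite !tau0.
move=> rn nN; elim: r rn t => [|m IHm] mn t t0; first by rewrite !tau0.
have k0 : 0 < (a n.+1)^-1 by rewrite invr_gt0 a_gt0.
have nN' : (n <= N)%N by exact: ltnW.
have mn' : (m <= n)%N by [].
have cross u : tauD (c n.+1 u) m.+1 * tauD (c n u) m - tauD (c n u) m.+1 * tauD (c
  n.+1 u) m =
    (a n.+1)^-1 * tauF (c n.+1 u) m.+1 * tauE (c n u) m.
  by rewrite (c_level u nN) tau_cross.
have F_gt0 : 0 < tauF (c n.+1 t) m.+1.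
  suff: 0 < (a n.+1)^-1 * tauF (c n.+1 t) m.+1 * tauE (c n t) m.
    by rewrite pmulr_lgt0 ?pmulr_rgt0 //; have [] := IHn m t mn' nN' t0.
  rewrite -cross.
  have [->|mn1] := eqVneq m n.
    by rewrite flow_tauD_top // mul0r subr0 mulr_gt0 // D_gt0.
  have mn2 : (m < n)%N by rewrite ltn_neqAle mn1.
  pose g u := tauD (c n.+1 u) m.+1 / tauD (c n.+1 u) m - tauD (c n u) m.+1 / tauD (c
    n u) m.
  pose g' u := - (tauF (c n.+1 u) m.+1 * tauE (c n.+1 u) m) / tauD (c n.+1 u) m ^+ 2 -
     - (tauF (c n u) m.+1 * tauE (c n u) m) / tauD (c n u) m ^+ 2.
  have gE u : 0 < u -> g u = (tauD (c n.+1 u) m.+1 * tauD (c n u) m - tauD (c n u)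
    m.+1 * tauD (c n.+1 u) m)
     / (tauD (c n.+1 u) m * tauD (c n u) m).
    by move=> u0; rewrite /g; field; rewrite !flow_tauD_neq0 ?(ltW u0) //; lia.
  have dpos u : 0 < u -> 0 < tauD (c n.+1 u) m * tauD (c n u) m.
    by move=> u0; rewrite mulr_gt0 // D_gt0 // ltnW.
  have : 0 < g t.
    apply: (@gt0_of_derive _ g g') => // [u u0||u u0 gu].
    - by apply: is_deriveB; apply: flow_ratio_derive => //;
      rewrite flow_tauD_neq0 // ltnW.
    - by rewrite /g !flow_tauD_init ?subrr // ltnW.
    - move: gu; rewrite gE // cross pmulr_lle0 ?invr_gt0 ?dpos //.
      have [F'0 _] := IHn m.+1 u mn2 nN' u0.
      have [_ E'0] := IHn m u mn' nN' u0.
      have [_ E0] := IHm (ltnW mn) u u0.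
      rewrite pmulr_lle0 // pmulr_rle0 // => F0.
      rewrite /g' mulNr mulNr opprK addrC subr_gt0.
      apply: (@le_lt_trans _ _ 0).
        by rewrite pmulr_lle0 ?invr_gt0 ?exprn_gt0 ?pmulr_lle0 // D_gt0 // ltnW.
      by rewrite !mulr_gt0 ?invr_gt0 ?exprn_gt0 // D_gt0.
  by rewrite gE // pmulr_lgt0 // invr_gt0 dpos.
split=> //.
suff: 0 < tauE (c n.+1 t) m.+1 * tauF (c n.+1 t) m.+1 by rewrite pmulr_lgt0.
rewrite -tau_condensation.
have D1 : 0 < tauD (c n.+1 t) m.+1 by rewrite D_gt0.
have [->|mn1] := eqVneq m n.
  by rewrite flow_tauD_top // mul0r subr0 exprn_gt0 // D_gt0.
have mn2 : (m < n)%N by rewrite ltn_neqAle mn1.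
have A : 0 < tauD (c n.+1 t) m.+1 * tauD (c n t) m.+1 - tauD (c n.+1 t) m.+2 * tauD
  (c n t) m.
  rewrite (c_level t nN) tau_interlace -(c_level t nN) mulr_gt0 //.
  by have [] := IHn m.+1 t mn2 nN' t0.
have B : 0 < tauD (c n.+1 t) m.+1 * tauD (c n t) m - tauD (c n t) m.+1 * tauD (c n.+1
  t) m.
  by rewrite cross !mulr_gt0 //; have [] := IHn m t mn' nN' t0.
have D2 : 0 < tauD (c n.+1 t) m.+2 by rewrite D_gt0.
have D1' : 0 < tauD (c n t) m.+1 by rewrite D_gt0.
rewrite -(pmulr_rgt0 _ D1').
rewrite [X in 0 < X](_ : _ = tauD (c n.+1 t) m.+1 * (tauD (c n.+1 t) m.+1 * tauD (c n
  t) m.+1 - tauD (c n.+1 t) m.+2 * tauD (c n t) m)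
  + tauD (c n.+1 t) m.+2 * (tauD (c n.+1 t) m.+1 * tauD (c n t) m - tauD (c n t) m.+1
    * tauD (c n.+1 t) m)); last by ring.
by rewrite addr_gt0 // mulr_gt0.
Qed.

(** For m = 0 the denominator is 1 - c_(-1), which starts from 0 and has the
derivative c_0 = F_1 > 0.  For m > 0 it is the quotient of positive numbers given by
the interlacing relation. *)
Lemma flow_denominator_neq0 n m t : (m <= n)%N -> (n < N)%N -> 0 < t ->
  1 - yratio (tauD (c n.+1 t)) m.+1 / yratio (tauD (c n t)) m != 0.
Proof.
move=> mn nN t0; case: m mn => [|m] mn.
  have := @gt0_of_derive _ (fun u => 1 - c n.+1 u (-1)) (fun u => 0 - - c n.+1 u (-1
    + 1)).
  move=> /(_ (fun u _ => is_deriveB (is_derive_cst (1 : R) u 1) (c_flow u (-1) nN))).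
  rewrite c_init // subrr => /(_ erefl) h.
  rewrite /= /tauD toeplitz1 toeplitz0 !divr1 gt_eqF //; apply: h => // u u0 _.
  have [] := @flow_tauEF_gt0 n.+1 1 u isT nN u0.
  by rewrite /tauF toeplitz1 sub0r opprK.
have nz (r k : nat) : (r <= k)%N -> (k <= N)%N -> tauD (c k t) r != 0.
  by move=> rk kN; rewrite flow_tauD_neq0 // ltW.
have -> : 1 - yratio (tauD (c n.+1 t)) m.+2 / yratio (tauD (c n t)) m.+1 =
   tauF (c n.+1 t) m.+1 * tauE (c n t) m.+1 / (tauD (c n.+1 t) m.+1 * tauD (c n t)
     m.+1).
  rewrite (c_level t nN) -tau_interlace -(c_level t nN) /=; field.
  by rewrite !nz //; lia.
have [F0 _] := @flow_tauEF_gt0 n.+1 m.+1 t (ltnW mn) nN t0.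
have [_ E0] := @flow_tauEF_gt0 n m.+1 t mn (ltnW nN) t0.
by rewrite !mulf_neq0 ?invr_neq0 ?mulf_neq0 ?nz ?gt_eqF //; lia.
Qed.

End moment_flow.

(** * Complex functions of a real variable *)

Section components.
Local Open Scope classical_set_scope.
Local Open Scope complex_scope.
Variable R : realType.
Implicit Types (x y z : R[i]).

Lemma complexReD x y : complex.Re (x + y) = complex.Re x + complex.Re y.
Proof. by case: x; case: y. Qed.
Lemma complexImD x y : complex.Im (x + y) = complex.Im x + complex.Im y.
Proof. by case: x; case: y. Qed.
Lemma complexReM x y : complex.Re (x * y) =
  complex.Re x * complex.Re y - complex.Im x * complex.Im y.
Proof. by case: x; case: y. Qed.
Lemma complexImM x y : complex.Im (x * y) =
  complex.Re x * complex.Im y + complex.Im x * complex.Re y.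
Proof. by case: x; case: y. Qed.
Lemma complexReV x : complex.Re x^-1 = complex.Re x / (complex.Re x ^+ 2 + complex.Im
  x ^+ 2).
Proof. by case: x. Qed.
Lemma complexImV x : complex.Im x^-1 = - complex.Im x / (complex.Re x ^+ 2 +
  complex.Im x ^+ 2).
Proof. by case: x => a b /=; rewrite mulNr. Qed.
Lemma complex_ReIm x y : complex.Re x = complex.Re y -> complex.Im x = complex.Im y
  -> x = y.
Proof. by case: x => a b; case: y => c d /= -> ->. Qed.
Lemma sqr_norm_neq0 x : x != 0 -> complex.Re x ^+ 2 + complex.Im x ^+ 2 != 0.
Proof.
case: x => a b; rewrite eq_complex /= negb_and => h.
rewrite paddr_eq0 ?sqr_ge0 // !sqrf_eq0; exact/nandP/orP.
Qed.

End components.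

Section path_continuity.
Local Open Scope classical_set_scope.
Local Open Scope complex_scope.
Variable R : realType.
Implicit Types (h k : R -> R[i]).

(** Continuity of the two real components is the form in which the theory of real
integrals can use it. *)
Definition cont01 h :=
  {within `[0%R, 1%R], continuous (fun s => complex.Re (h s))} /\
  {within `[0%R, 1%R], continuous (fun s => complex.Im (h s))}.

Lemma within_continuousP (f : R -> R) :
  {within `[0%R, 1%R], continuous f} <->
  forall s : R, 0 <= s <= 1 -> f @ within `[0%R, 1%R] (nbhs s) --> f s.
Proof.
split=> [/subspace_continuousP fc s s01|fc].
  by apply: fc; rewrite /= in_itv.
by apply/subspace_continuousP => s; rewrite /= in_itv /= => s01; exact: fc.
Qed.

Lemma cont01_cst z : cont01 (fun=> z).
Proof. by split; apply: cst_continuous. Qed.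

Lemma cont01D h k : cont01 h -> cont01 k -> cont01 (fun s => h s + k s).
Proof.
move=> [hr hi] [kr ki]; split.
  rewrite (funext (fun s => complexReD (h s) (k s))).
  by move=> s; apply: cvgD; [exact: hr|exact: kr].
rewrite (funext (fun s => complexImD (h s) (k s))).
by move=> s; apply: cvgD; [exact: hi|exact: ki].
Qed.

Lemma cont01M h k : cont01 h -> cont01 k -> cont01 (fun s => h s * k s).
Proof.
move=> [hr hi] [kr ki]; split.
  rewrite (funext (fun s => complexReM (h s) (k s))).
  by move=> s; apply: cvgB; apply: cvgM; [exact: hr|exact: kr|exact: hi|exact: ki].
rewrite (funext (fun s => complexImM (h s) (k s))).
by move=> s; apply: cvgD; apply: cvgM; [exact: hr|exact: ki|exact: hi|exact: kr].
Qed.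

Lemma cont01V h : cont01 h -> (forall s : R, 0 <= s <= 1 -> h s != 0) ->
  cont01 (fun s => (h s)^-1).
Proof.
move=> [/within_continuousP hr /within_continuousP hi] h0.
have den (s : R) : 0 <= s <= 1 -> (fun s => (complex.Re (h s) ^+ 2 + complex.Im (h s)
  ^+ 2)^-1)
    @ within `[0%R, 1%R] (nbhs s) --> (complex.Re (h s) ^+ 2 + complex.Im (h s) ^+
      2)^-1.
  move=> s01; apply: cvgV; first exact/sqr_norm_neq0/h0.
  by rewrite !expr2; apply: cvgD; apply: cvgM; (exact: hr || exact: hi).
split; apply/within_continuousP => s s01.
  rewrite (funext (fun s => complexReV (h s))).
  by rewrite complexReV; apply: cvgM; [exact: hr | exact: den].
rewrite (funext (fun s => complexImV (h s))).
by rewrite complexImV; apply: cvgM; [apply: cvgN; exact: hi | exact: den].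
Qed.

Lemma cont01_prod (I : Type) (r : seq I) (P : pred I) (h : I -> R -> R[i]) :
  (forall i, P i -> cont01 (h i)) -> cont01 (fun s => \prod_(i <- r | P i) h i s).
Proof.
move=> hc; elim: r => [|i r IH].
  rewrite (_ : (fun s => _) = fun=> 1); first exact: cont01_cst.
  by apply/funext => s; rewrite big_nil.
rewrite (_ : (fun s => _) = fun s => (if P i then h i s else 1) * \prod_(i <- r | P
  i) h i s).
  apply: cont01M => //; case Pi : (P i); [exact: hc|exact: cont01_cst].
by apply/funext => s; rewrite big_cons; case: ifP => _ //; rewrite mul1r.
Qed.

Lemma cont01X h n : cont01 h -> cont01 (fun s => h s ^+ n).
Proof.
move=> hc; elim: n => [|n IH]; first exact: cont01_cst.
rewrite (funext (fun s => exprS (h s) n)); exact: cont01M.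
Qed.

Lemma cont01Xz h (q : int) : cont01 h -> (forall s : R, 0 <= s <= 1 -> h s != 0) ->
  cont01 (fun s => h s ^ q).
Proof.
move=> hc h0; case: q => n; first exact: cont01X.
by apply: cont01V => [|s s01]; [exact: cont01X | rewrite expf_neq0 // h0].
Qed.

Lemma cont01_cexp h : cont01 h -> cont01 (fun s => cexp (h s)).
Proof.
move=> [hr hi].
have er : {within `[0%R, 1%R], continuous (fun s => expR (complex.Re (h s)))}.
  by move=> s; apply: (continuous_comp (hr s)); exact: continuous_expR.
split=> s; apply: cvgM; [exact: er| |exact: er|].
  by apply: (continuous_comp (hi s)); exact: continuous_cos.
by apply: (continuous_comp (hi s)); exact: continuous_sin.
Qed.

End path_continuity.

Section path_derivative.
Local Open Scope classical_set_scope.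
Local Open Scope complex_scope.
Variable R : realType.
Implicit Types (h k : R -> R[i]).

Definition cderiv h (s : R) (d : R[i]) :=
  is_derive s 1 (fun t => complex.Re (h t)) (complex.Re d) /\
  is_derive s 1 (fun t => complex.Im (h t)) (complex.Im d).

Lemma cderiv_cst z s : cderiv (fun=> z) s 0.
Proof. by split; exact: is_derive_cst. Qed.

Lemma cderiv_eq h s d d' : cderiv h s d -> d = d' -> cderiv h s d'.
Proof. by move=> hd <-. Qed.

Lemma cderivD h k s d e : cderiv h s d -> cderiv k s e ->
  cderiv (fun t => h t + k t) s (d + e).
Proof.
move=> [hr hi] [kr ki]; split.
  rewrite (funext (fun t => complexReD (h t) (k t))).
  by rewrite complexReD; exact: is_deriveD.
rewrite (funext (fun t => complexImD (h t) (k t))).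
by rewrite complexImD; exact: is_deriveD.
Qed.

Lemma cderivM h k s d e : cderiv h s d -> cderiv k s e ->
  cderiv (fun t => h t * k t) s (h s * e + d * k s).
Proof.
move=> [hr hi] [kr ki]; split.
  rewrite (funext (fun t => complexReM (h t) (k t))).
  apply: is_derive_eq (is_deriveB (is_derive_mul hr kr) (is_derive_mul hi ki)) _.
  by rewrite complexReD !complexReM; ring.
rewrite (funext (fun t => complexImM (h t) (k t))).
apply: is_derive_eq (is_deriveD (is_derive_mul hr ki) (is_derive_mul hi kr)) _.
by rewrite complexImD !complexImM; ring.
Qed.

Lemma cderivV h s d : cderiv h s d -> h s != 0 ->
  cderiv (fun t => (h t)^-1) s (- (h s) ^- 2 * d).
Proof.
move=> [hr hi] /sqr_norm_neq0 h0.
have dn : is_derive s 1 (fun t => complex.Re (h t) * complex.Re (h t) +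
   complex.Im (h t) * complex.Im (h t)) _ :=
  is_deriveD (is_derive_mul hr hr) (is_derive_mul hi hi).
have h0' : complex.Re (h s) * complex.Re (h s) + complex.Im (h s) * complex.Im (h s)
  != 0.
  by rewrite -!expr2.
have sqr_normE (x y : R) : (x * x - y * y) ^+ 2 + (x * y + y * x) ^+ 2 = (x * x + y *
  y) ^+ 2.
  by ring.
have dv := @is_deriveV _ (fun t => complex.Re (h t) * complex.Re (h t) +
   complex.Im (h t) * complex.Im (h t)) _ _ _ h0' dn.
split.
  rewrite (funext (fun t => complexReV (h t))); under eq_fun do rewrite !expr2.
  apply: is_derive_eq (is_derive_mul hr dv) _.
  case: (h s) d h0 hr hi dn dv h0' => x y [u v] /= h0 _ _ _ _ h0'.
  rewrite /GRing.scale /=; field.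
  by rewrite h0' (sqr_normE x y) expf_neq0.
rewrite (funext (fun t => complexImV (h t))); under eq_fun do rewrite !expr2.
have hin : is_derive s 1 (fun t => - complex.Im (h t)) (- complex.Im d) := is_deriveN
  hi.
apply: is_derive_eq (is_derive_mul hin dv) _.
case: (h s) d h0 hr hi hin dn dv h0' => x y [u v] /= h0 _ _ _ _ _ h0'.
rewrite /GRing.scale /=; field.
by rewrite h0' (sqr_normE x y) expf_neq0.
Qed.

Lemma cderivX h s d n : cderiv h s d ->
  cderiv (fun t => h t ^+ n.+1) s (n.+1%:R * h s ^+ n * d).
Proof.
move=> hd; elim: n => [|n IH].
  by rewrite expr0 !mul1r.
rewrite (funext (fun t => exprS (h t) n.+1)).
apply: cderiv_eq (cderivM hd IH) _.
by rewrite -(natr1 n.+1) exprS; ring.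
Qed.

Lemma cderiv_cexp h s d : cderiv h s d ->
  cderiv (fun t => cexp (h t)) s (cexp (h s) * d).
Proof.
move=> [hr hi].
have er := is_derive1_comp (is_derive_expR (complex.Re (h s))) hr.
have cr := is_derive1_comp (is_derive_cos (complex.Im (h s))) hi.
have sr := is_derive1_comp (is_derive_sin (complex.Im (h s))) hi.
split.
  apply: is_derive_eq (is_derive_mul er cr) _.
  by rewrite complexReM /=; ring.
apply: is_derive_eq (is_derive_mul er sr) _.
by rewrite complexImM /=; ring.
Qed.

End path_derivative.

(** * Contour integrals *)

Section complex_integral.
Local Open Scope classical_set_scope.
Local Open Scope complex_scope.
Variable R : realType.
Implicit Types (h k : R -> R[i]) (f : R -> R).
Notation mu := (@lebesgue_measure R).

Lemma integrable01 f : {within `[0%R, 1%R], continuous f} ->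
  mu.-integrable `[0%R, 1%R] (EFin \o f).
Proof. by move=> fc; apply: continuous_compact_integrable => //;
  exact: segment_compact. Qed.

Definition cint h : R[i] :=
  (\int[mu]_(s in `[0%R, 1%R]) complex.Re (h s))
  +i* (\int[mu]_(s in `[0%R, 1%R]) complex.Im (h s)).

Lemma eq_cint h k : (forall s : R, 0 <= s <= 1 -> h s = k s) -> cint h = cint k.
Proof.
move=> hk; apply: complex_ReIm => /=; apply: eq_Rintegral => s;
  by rewrite inE /= in_itv /= => s01; rewrite hk.
Qed.

Lemma cintD h k : cont01 h -> cont01 k -> cint (fun s => h s + k s) = cint h + cint k.
Proof.
move=> [hr hi] [kr ki]; apply: complex_ReIm => /=.
  under eq_Rintegral do rewrite complexReD.
  by rewrite RintegralD //; exact: integrable01.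
under eq_Rintegral do rewrite complexImD.
by rewrite RintegralD //; exact: integrable01.
Qed.

Lemma cintZ z h : cont01 h -> cint (fun s => z * h s) = z * cint h.
Proof.
case: z => a b [hr hi].
have iz (x : R) f : {within `[0%R, 1%R], continuous f} ->
    mu.-integrable `[0%R, 1%R] (EFin \o (fun s => x * f s)).
  by move=> fc; apply: integrable01 => s; apply: cvgM; [exact: cvg_cst | exact: fc].
apply: complex_ReIm => /=.
  under eq_Rintegral do rewrite complexReM /=.
  have ir := integrable01 hr; have ii := integrable01 hi.
  by rewrite RintegralB ?RintegralZl //; exact: iz.
under eq_Rintegral do rewrite complexImM /=.
have ir := integrable01 hr; have ii := integrable01 hi.
by rewrite RintegralD ?RintegralZl //; exact: iz.
Qed.

Lemma FTC01 (f f' : R -> R) : {within `[0%R, 1%R], continuous f'} ->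
  (forall s : R, 0 <= s <= 1 -> is_derive s 1 f (f' s)) ->
  \int[mu]_(s in `[0%R, 1%R]) f' s = f 1 - f 0.
Proof.
move=> f'c df; rewrite /Rintegral (@continuous_FTC2 _ f' f 0 1) //=.
  have ct (s : R) : 0 <= s <= 1 -> {for s, continuous f}.
    move=> s01; apply/differentiable_continuous/derivable1_diffP.
    exact: (@ex_derive _ _ _ _ _ _ _ (df s s01)).
  split.
  - move=> s; rewrite in_itv /= => /andP[s0 s1].
    have s01 : 0 <= s <= 1 by rewrite !ltW.
    exact: (@ex_derive _ _ _ _ _ _ _ (df s s01)).
  - by apply: cvg_at_right_filter; apply: ct; rewrite lexx ler01.
  - by apply: cvg_at_left_filter; apply: ct; rewrite lexx ler01.
move=> s; rewrite in_itv /= => /andP[s0 s1].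
have s01 : 0 <= s <= 1 by rewrite !ltW.
by rewrite derive1E (@derive_val _ _ _ _ _ _ _ (df s s01)).
Qed.

Lemma cint_derivative h h' : cont01 h' ->
  (forall s : R, 0 <= s <= 1 -> cderiv h s (h' s)) -> cint h' = h 1 - h 0.
Proof.
move=> [cr ci] dh; have dr s s01 := (dh s s01).1; have di s s01 := (dh s s01).2.
have := FTC01 cr dr; have := FTC01 ci di.
rewrite /cint; case: (h 1) (h 0) => x y [u v] /= ei er.
by apply: complex_ReIm => /=; [exact: er | exact: ei].
Qed.

End complex_integral.

Section contour_integral.
Local Open Scope classical_set_scope.
Local Open Scope complex_scope.
Variable R : realType.
Variable g : R -> R[i].
Hypothesis g_C1 : C1_path g.
Implicit Types f : R[i] -> R[i].

Lemma cderiv_path s : cderiv g s (path_deriv g s).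
Proof.
have [dr di _ _] := g_C1; split=> /=.
  by apply: DeriveDef; [exact: dr | rewrite derive1E].
by apply: DeriveDef; [exact: di | rewrite derive1E].
Qed.

Lemma cont01_path : cont01 g.
Proof.
split; apply: derivable_within_continuous => s _.
  by have [+ _ _ _] := g_C1; apply.
by have [_ + _ _] := g_C1; apply.
Qed.

Lemma cont01_path_deriv : cont01 (path_deriv g).
Proof. by have [_ _ cr ci] := g_C1; split; exact: continuous_subspaceT. Qed.

Definition cont_on f := cont01 (fun s => f (g s)).

Lemma oint_cint f : oint g f = cint (fun s => f (g s) * path_deriv g s).
Proof. by []. Qed.

Lemma cont01_integrand f : cont_on f -> cont01 (fun s => f (g s) * path_deriv g s).
Proof. by move=> fc; apply: cont01M fc cont01_path_deriv. Qed.

Lemma eq_oint f1 f2 : (forall s : R, 0 <= s <= 1 -> f1 (g s) = f2 (g s)) ->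
  oint g f1 = oint g f2.
Proof. by move=> f12; rewrite !oint_cint; apply: eq_cint => s /f12 ->. Qed.

Lemma ointD f1 f2 : cont_on f1 -> cont_on f2 ->
  oint g (fun z => f1 z + f2 z) = oint g f1 + oint g f2.
Proof.
move=> c1 c2; rewrite !oint_cint -cintD; [|exact: cont01_integrand..].
by apply: eq_cint => s _; rewrite mulrDl.
Qed.

Lemma ointZ c f : cont_on f -> oint g (fun z => c * f z) = c * oint g f.
Proof.
move=> fc; rewrite !oint_cint -cintZ; last exact: cont01_integrand.
by apply: eq_cint => s _; rewrite mulrA.
Qed.

Lemma oint_sum (I : Type) (r : seq I) (f : I -> R[i] -> R[i]) :
  (forall i, cont_on (f i)) ->
  oint g (fun z => \sum_(i <- r) f i z) = \sum_(i <- r) oint g (f i).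
Proof.
move=> fc.
have sc (s : seq I) : cont_on (fun z => \sum_(i <- s) f i z).
  rewrite /cont_on; elim: s => [|i s IH].
    by rewrite (funext (fun s => big_nil _ _ _ _)); exact: cont01_cst.
  rewrite (funext (fun s => big_cons _ _ _ _ _ _)) /=; exact: cont01D (fc i) IH.
elim: r => [|i r IH].
  rewrite big_nil -[RHS](mul0r (oint g (fun=> 1))) -ointZ; last exact: cont01_cst.
  by apply: eq_oint => s _; rewrite big_nil mul0r.
rewrite big_cons -IH -ointD //.
by apply: eq_oint => s _; rewrite big_cons.
Qed.

(** Every contour integral computed below reduces to integrands with a primitive
along the loop and to winding numbers. *)
Lemma oint_exact (F f : R[i] -> R[i]) : g 0 = g 1 -> cont_on f ->
  (forall s : R, 0 <= s <= 1 ->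
     cderiv (fun t => F (g t)) s (f (g s) * path_deriv g s)) ->
  oint g f = 0.
Proof.
move=> g01 fc dF; rewrite oint_cint (cint_derivative _ dF) ?g01 ?subrr //.
exact: cont01_integrand.
Qed.

End contour_integral.

(** * Moments of a loop *)

Section moments.
Local Open Scope classical_set_scope.
Local Open Scope complex_scope.
Variable R : realType.
Implicit Types (a : nat -> R) (w : R[i] -> R[i]) (g : R -> R[i]).

Definition kern a n (z : R[i]) : R[i] :=
  \prod_(1 <= l < n.+1) ((a l)%:C / ((a l)%:C - z)).

(** The factor a / (a - z) has residue - a at its pole; the sign compensates for
it. *)
Definition moment a w g n (q : int) : R[i] :=
  - (twopii^-1 * oint g (fun z => z ^ q * (kern a n z * w z))).

Lemma twopii_neq0 : twopii != 0 :> R[i].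
Proof.
by rewrite /twopii eq_complex /= negb_and mulf_neq0 ?orbT ?gt_eqF ?pi_gt0 //.
Qed.

Lemma kern0 a z : kern a 0 z = 1.
Proof. by rewrite /kern big_geq. Qed.

Lemma kernS a n z : kern a n.+1 z = kern a n z * ((a n.+1)%:C / ((a n.+1)%:C - z)).
Proof. by rewrite /kern big_nat_recr. Qed.

Section loop.
Variables (a : nat -> R) (n : nat) (g : R -> R[i]).
Hypothesis g_adm : admissible_loop a n g.

Lemma loop_C1 : C1_path g.
Proof. by have [[]] := g_adm. Qed.

Lemma loop_closed : g 0 = g 1.
Proof. by have [[]] := g_adm. Qed.

Lemma loop_neq0 (s : R) : 0 <= s <= 1 -> g s != 0.
Proof. by have [_ _ [+ _]] := g_adm; apply. Qed.

Lemma loop_neq_pole l (s : R) : (1 <= l <= n)%N -> 0 <= s <= 1 -> (a l)%:C - g s != 0.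
Proof.
by move=> ln s01; have [_ /(_ l ln) [+ _] _] := g_adm; rewrite subr_eq0 eq_sym; apply.
Qed.

Lemma cont_on_id : cont_on g id.
Proof. exact: cont01_path loop_C1. Qed.

Lemma cont_on_expz q : cont_on g (fun z => z ^ q).
Proof. by apply: cont01Xz; [exact: cont_on_id | exact: loop_neq0]. Qed.

Lemma cont_on_pole (x : R) : (forall s : R, 0 <= s <= 1 -> x%:C - g s != 0) ->
  cont_on g (fun z => (x%:C - z)^-1).
Proof.
move=> xg; apply: (cont01V (h := fun s => x%:C - g s)) => //.
rewrite (funext (fun s => esym (congr1 (+%R x%:C) (mulN1r (g s))))).
apply: cont01D (cont01_cst _) _; apply: cont01M (cont01_cst _) _; exact: cont_on_id.
Qed.

Lemma cont_on_kern m : (m <= n)%N -> cont_on g (kern a m).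
Proof.
move=> mn; rewrite /cont_on /kern; under eq_fun do rewrite big_seq_cond.
apply: cont01_prod => l /andP[]; rewrite mem_index_iota => /andP[l1 lm] _.
apply: cont01M (cont01_cst _) _; apply: (@cont_on_pole (a l)) => s s01.
by apply: loop_neq_pole => //; rewrite l1 /=; apply: leq_trans mn; rewrite -ltnS.
Qed.

Lemma cont_on_moment w m q : (m <= n)%N -> cont_on g w ->
  cont_on g (fun z => z ^ q * (kern a m z * w z)).
Proof.
move=> mn wc; apply: cont01M; first exact: cont_on_expz.
by apply: cont01M; first exact: cont_on_kern.
Qed.

(** Both lowering the level and advancing the time multiply the integrand by a
factor 1 - k z. *)
Lemma moment_comb w w' m m' q k : (m <= n)%N -> cont_on g w ->
  (forall s : R, 0 <= s <= 1 ->
    kern a m' (g s) * w' (g s) = kern a m (g s) * w (g s) * (1 - k * g s)) ->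
  moment a w' g m' q = moment a w g m q - k * moment a w g m (q + 1).
Proof.
move=> mn wc ww'; rewrite /moment.
transitivity (- (twopii^-1 * oint g (fun z => z ^ q * (kern a m z * w z) +
    (- k) * (z ^ (q + 1) * (kern a m z * w z))))).
  congr (- (_ * _)); apply: eq_oint => s s01.
  rewrite ww' // expfzDr ?loop_neq0 // expr1z; ring.
rewrite ointD ?ointZ; first by ring.
all: try exact: loop_C1.
all: try exact: cont_on_moment.
by apply: cont01M (cont01_cst _) _; exact: cont_on_moment.
Qed.

Lemma moment_level w m q : (m < n)%N -> a m.+1 != 0 -> cont_on g w ->
  moment a w g m q = moment a w g m.+1 q - ((a m.+1)^-1)%:C * moment a w g m.+1 (q + 1).
Proof.
move=> mn a0 wc; apply: moment_comb => // s s01.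
have az : (a m.+1)%:C - g s != 0 by apply: loop_neq_pole.
have ac : (a m.+1)%:C != 0 :> R[i] by rewrite (inj_eq (@complexI R) _ 0).
rewrite kernS (fmorphV (real_complex R)); field; by rewrite az ac.
Qed.

Lemma oint_expz q : q != -1 -> oint g (fun z => z ^ q) = 0.
Proof.
move=> q1; have q10 : (q + 1)%:~R != 0 :> R[i].
  by rewrite intr_eq0; lia.
apply: (oint_exact loop_C1 (F := fun z => (q + 1)%:~R^-1 * z ^ (q + 1)) loop_closed).
  exact: cont_on_expz.
move=> s s01; have gs0 := loop_neq0 s01.
have dg := cderiv_path loop_C1 s.
suff dX : cderiv (fun t => g t ^ (q + 1)) s ((q + 1)%:~R * g s ^ q * path_deriv g s).
  apply: cderiv_eq (cderivM (cderiv_cst _ _) dX) _.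
  by rewrite mul0r addr0 !mulrA mulVf // mul1r.
case: q q1 q10 => [m|[//|m]] _ _.
  by rewrite (_ : m%:Z + 1 = m.+1%:Z); [exact: cderivX m dg | lia].
rewrite (_ : Negz m.+1 + 1 = Negz m); last by rewrite !NegzE; lia.
have dV : cderiv (fun t => g t ^ Negz m) s _ := cderivV (cderivX m dg) (expf_neq0
  m.+1 gs0).
apply: cderiv_eq dV _.
rewrite -[g s ^ Negz m.+1]/((g s ^+ m.+2)^-1) NegzE mulrNz -pmulrn !exprS.
by field; rewrite expf_neq0 // gs0.
Qed.

Lemma oint_inverse : oint g (fun z => z ^ (-1)) = 0.
Proof.
have [_ _ [_ wd]] := g_adm.
have /eqP := wd; rewrite /winding mulf_eq0 invr_eq0 (negbTE twopii_neq0) /=.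
move=> /eqP <-; apply: eq_oint => s _; by rewrite subr0.
Qed.

(** Two distinct poles x and y are separated by partial fractions; the two
resulting products have equally many factors, hence equal integrals by induction, and
their difference vanishes.  A single multiple pole has a primitive, and a simple pole
is counted by the winding number. *)
Lemma oint_pole_product (s : seq R) : (0 < size s)%N ->
  (forall x, x \in s -> encloses_ccw g x%:C) ->
  oint g (fun z => \prod_(x <- s) (x%:C - z)^-1) =
  if size s == 1%N then - twopii else 0.
Proof.
have [k] := ubnP (size s); elim: k s => // k IH s sk s0 es.
have pole x t : x \in s -> 0 <= t <= 1 -> x%:C - g t != 0.
  by move=> /es [ex _] t01; rewrite subr_eq0 eq_sym ex.
have cprod r : {subset r <= s} -> cont_on g (fun z => \prod_(x <- r) (x%:C - z)^-1).
  move=> rs; rewrite /cont_on; under eq_fun do rewrite big_seq.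
  by apply: cont01_prod => x xr; apply: cont_on_pole => t; apply: pole; exact: rs.
case: s => // x s in sk s0 es pole cprod *.
have xin : x \in x :: s by rewrite mem_head.
case: (altP (s =P [::])) => [s1|sn].
  subst s; rewrite eqxx.
  transitivity (oint g (fun z => -1 * (z - x%:C)^-1)).
    apply: eq_oint => t t01; rewrite big_cons big_nil mulr1.
    by rewrite -[x%:C - g t]opprB invrN mulN1r.
  rewrite ointZ; [| exact: loop_C1 | ].
    have [_ /eqP] := es x xin; rewrite /winding mulrC.
    rewrite -(inj_eq (mulIf twopii_neq0)) mulfVK ?twopii_neq0 // mul1r => /eqP ->.
    by rewrite mulN1r.
  apply: (cont01V (h := fun t => g t - x%:C)) => [|t t01].
    exact: cont01D cont_on_id (cont01_cst _).
  by rewrite -oppr_eq0 opprB pole.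
have ss0 : (0 < size s)%N by rewrite lt0n size_eq0.
rewrite eqSS eqn0Ngt ss0 /=.
have [allx|] := boolP (all (pred1 x) s).
  have -> : s = nseq (size s).-1.+1 x by rewrite prednK //; exact/all_pred1P.
  move: (size s).-1 => m.
  (* Here all poles equal x and F is a primitive. *)
  pose F (z : R[i]) : R[i] := m.+1%:R^-1 * (x%:C - z)^-1 ^+ m.+1.
  apply: (oint_exact loop_C1 (F := F) loop_closed).
    rewrite /cont_on; under eq_fun do rewrite big_seq.
    apply: cont01_prod => y yr; apply: cont_on_pole => t; apply: pole.
    by move: yr; rewrite inE mem_nseq /= => /orP[/eqP ->|/eqP ->].
  move=> t t01; have xt := pole x t xin t01.
  have dx : cderiv (fun u => x%:C - g u) t (- path_deriv g t).
    have := cderivD (cderiv_cst x%:C t) (cderivM (cderiv_cst (-1) t) (cderiv_path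
      loop_C1 t)).
    rewrite (funext (fun u => congr1 (+%R x%:C) (mulN1r (g u)))).
    by move/cderiv_eq; apply; rewrite mul0r addr0 add0r mulN1r.
  apply: cderiv_eq (cderivM (cderiv_cst _ t) (cderivX m (cderivV dx xt))) _.
  rewrite big_cons big_nseq iter_mulr_1 mul0r addr0.
  have m0 : m.+1%:R != 0 :> R[i] by rewrite pnatr_eq0.
  rewrite !exprVn !exprS; field.
  by rewrite expf_neq0 ?xt // nat1r m0.
move=> /allPn[y ys /= yx].
set r := rem y s.
have yin : y \in x :: s by rewrite inE ys orbT.
have rs z : z \in r -> z \in x :: s by move=> /mem_rem zs; rewrite inE zs orbT.
have sr : size s = (size r).+1 by rewrite size_rem // prednK.
have sub v : v \in x :: s -> {subset v :: r <= x :: s}.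
  by move=> vs z; rewrite inE => /orP[/eqP ->|/rs].
have dxy : y%:C - x%:C != 0 :> R[i].
  by rewrite subr_eq0 (inj_eq (@complexI R)).
have IHr v : v \in x :: s -> oint g (fun z => \prod_(u <- v :: r) (u%:C - z)^-1) =
    if size (v :: r) == 1%N then - twopii else 0.
  move=> vs; apply: IH => //=; first by move: sk; rewrite /= sr.
  by move=> u /(sub v vs); exact: es.
transitivity (oint g (fun z => (y%:C - x%:C)^-1 * (\prod_(u <- x :: r) (u%:C - z)^-1 +
    (-1) * \prod_(u <- y :: r) (u%:C - z)^-1))).
  apply: eq_oint => t t01; rewrite big_cons (perm_big _ (perm_to_rem ys)) !big_cons
    -/r /=.
  by field; rewrite dxy !pole.
have cm : cont_on g (fun z => -1 * \prod_(u <- y :: r) (u%:C - z)^-1).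
  by apply: cont01M (cont01_cst _) _; apply: cprod; exact: sub.
have cx := cprod _ (sub x xin); have cy := cprod _ (sub y yin).
rewrite ointZ ?ointD ?ointZ ?IHr //; try exact: loop_C1.
  by rewrite /= mulN1r subrr mulr0.
exact: cont01D.
Qed.

Lemma moment1_level0 q : moment a (fun=> 1) g 0 q = 0.
Proof.
rewrite /moment (_ : oint g _ = 0) ?mulr0 ?oppr0 //.
transitivity (oint g (fun z => z ^ q)).
  by apply: eq_oint => s _; rewrite kern0 !mulr1.
have [->|q1] := eqVneq q (-1); [exact: oint_inverse | exact: oint_expz].
Qed.

Lemma moment1_zero m : (m < n)%N ->
  moment a (fun=> 1) g m.+1 0 = if m == 0%N then (a 1)%:C else 0.
Proof.
move=> mn; pose r := [seq a l | l <- index_iota 1 m.+2].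
have er x : x \in r -> encloses_ccw g x%:C.
  move=> /mapP[l]; rewrite mem_index_iota => /andP[l1 lm] ->.
  by have [_ + _] := g_adm; apply; rewrite l1 /=; lia.
rewrite /moment.
transitivity (- (twopii^-1 * oint g (fun z => \prod_(1 <= l < m.+2) (a l)%:C *
   \prod_(x <- r) (x%:C - z)^-1))).
  congr (- (_ * _)); apply: eq_oint => s _.
  by rewrite expr0z mul1r mulr1 /kern big_split /= big_map.
rewrite ointZ; [|exact: loop_C1|]; last first.
  rewrite /cont_on; under eq_fun do rewrite big_seq.
  apply: cont01_prod => x xr; apply: cont_on_pole => t t01.
  by have [ex _] := er x xr; rewrite subr_eq0 eq_sym ex.
rewrite oint_pole_product ?size_map ?size_iota //= eqSS.
case: eqP => [->|_]; last by rewrite !mulr0 oppr0.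
rewrite big_nat1 mulrN mulrN opprK mulrCA mulVf ?mulr1 //; exact: twopii_neq0.
Qed.

Lemma moment1_init m : (m < n)%N -> (forall l, (1 <= l <= n)%N -> a l != 0) ->
  moment a (fun=> 1) g m.+1 (-1) = 1.
Proof.
move=> mn a0; elim: m mn => [|m IH] mn.
  have := moment_level (w := fun=> 1) (-1) mn (a0 1%N mn) (cont01_cst 1).
  rewrite moment1_level0 addNr moment1_zero //= => /eqP.
  rewrite eq_sym subr_eq0 -rmorphM mulVf ?a0 // => /eqP ->.
  by rewrite rmorph1.
have := moment_level (w := fun=> 1) (-1) mn (a0 m.+2 mn) (cont01_cst 1).
by rewrite (IH (ltnW mn)) addNr moment1_zero //= mulr0 subr0.
Qed.

End loop.
End moments.

(** * Differentiation under the integral sign *)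

Section under_integral.
Local Open Scope classical_set_scope.
Local Open Scope complex_scope.
Variable R : realType.
Notation mu := (@lebesgue_measure R).
Notation cont f := ({within `[0%R, 1%R], continuous (f : R -> R)}).

(** This is the derivative of the integral of phi exp(- x g) in real terms: u and v
are the components of g, and A and B are those of phi, or of - i phi for the
imaginary part. *)
Lemma is_derive_int_exp_trig (u v A B : R -> R) (t : R) :
  cont u -> cont v -> cont A -> cont B ->
  is_derive t 1
   (fun x => \int[mu]_(s in `[0%R, 1%R])
     (expR (- (x * u s)) * (A s * cos (x * v s) + B s * sin (x * v s))))
   (\int[mu]_(s in `[0%R, 1%R])
     (expR (- (t * u s)) * (- u s * (A s * cos (t * v s) + B s * sin (t * v s))
        + v s * (B s * cos (t * v s) - A s * sin (t * v s))))).
Proof.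
move=> cu cv cA cB.
pose f x s := expR (- (x * u s)) * (A s * cos (x * v s) + B s * sin (x * v s)).
pose df x s := expR (- (x * u s)) * (- u s * (A s * cos (x * v s) + B s * sin (x * v s))
        + v s * (B s * cos (x * v s) - A s * sin (x * v s))).
have cZ (h : R -> R) x : cont h -> cont (fun s => x * h s).
  by move=> ch s; apply: cvgM; [exact: cvg_cst | exact: ch].
have cM (h k : R -> R) : cont h -> cont k -> cont (fun s => h s * k s).
  by move=> ch ck s; apply: cvgM; [exact: ch | exact: ck].
have cD (h k : R -> R) : cont h -> cont k -> cont (fun s => h s + k s).
  by move=> ch ck s; apply: cvgD; [exact: ch | exact: ck].
have cabs (h : R -> R) : cont h -> cont (fun s => `|h s|).
  by move=> ch s; apply: (continuous_comp (ch s)); exact: norm_continuous.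
have cexpR (h : R -> R) : cont h -> cont (fun s => expR (h s)).
  by move=> ch s; apply: (continuous_comp (ch s)); exact: continuous_expR.
have ccos (h : R -> R) : cont h -> cont (fun s => cos (h s)).
  by move=> ch s; apply: (continuous_comp (ch s)); exact: continuous_cos.
have csin (h : R -> R) : cont h -> cont (fun s => sin (h s)).
  by move=> ch s; apply: (continuous_comp (ch s)); exact: continuous_sin.
have cf x : cont (f x).
  apply: (cM _ _).
    by apply: (cexpR _) => s; apply: cvgN; exact: cZ.
  by apply: (cD _ _); apply: (cM _ _) => //; [apply: (ccos _)|apply: (csin _)];
    exact: cZ.
have dfE (x s : R) : is_derive x 1 (f^~ s) (df x s).
  have dv : is_derive x 1 (fun y => y * v s) (v s).
    by apply: is_derive_eq (is_derive_mul (is_derive_id x 1) (is_derive_cst (v s) x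
      1)) _;
      rewrite mulr0 add0r mul1r.
  have de : is_derive x 1 (fun y => expR (- (y * u s))) (- u s * expR (- (x * u s))).
    have := is_derive_expRM (- u s) x.
    by under eq_fun do rewrite mulNr mulrC; rewrite !mulNr (mulrC (u s) x).
  have dc := is_derive_mul (is_derive_cst (A s) x (1 : R)) (@is_derive1_comp R cos
    (fun y => y * v s) x _ (v s) (is_derive_cos (x * v s)) dv).
  have ds := is_derive_mul (is_derive_cst (B s) x (1 : R)) (@is_derive1_comp R sin
    (fun y => y * v s) x _ (v s) (is_derive_sin (x * v s)) dv).
  apply: is_derive_eq (is_derive_mul de (is_deriveD dc ds)) _.
  rewrite /df !fctE /GRing.scale /=; ring.
have dfb (x s : R) : `|df x s| <= expR (`|x| * `|u s|) * ((`|u s| + `|v s|) * (`|A s|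
  + `|B s|)).
  rewrite /df normrM ger0_norm ?expR_ge0 // ler_pM ?expR_ge0 //.
    by rewrite ler_expR -normrM -normrN; exact: ler_norm.
  have cs (p q y z : R) : `|p * cos y| + `|q * sin z| <= `|p| + `|q|.
    by rewrite lerD // normrM ler_piMr // ?cos_max ?sin_max.
  rewrite mulrDl; apply: le_trans (ler_normD _ _) _; apply: lerD;
    rewrite normrM ?normrN.
    by rewrite ler_wpM2l //; apply: le_trans (ler_normD _ _) (cs _ _ _ _).
  rewrite ler_wpM2l //; apply: le_trans (ler_normB _ _) _.
  by rewrite (addrC `|A s|); exact: cs.
pose G s := expR ((`|t| + 1) * `|u s|) * ((`|u s| + `|v s|) * (`|A s| + `|B s|)).
have cG : cont G.
  apply: (cM _ _); first by apply: (cexpR _); apply: (cZ _ _); exact: cabs.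
  by apply: (cM _ _); apply: (cD _ _); exact: cabs.
(* The domination is uniform on the interval of radius 1 around t. *)
have It : `]t - 1, t + 1[%classic t by rewrite /= in_itv /=; lra.
have intf (x : R) : `]t - 1, t + 1[%classic x ->
    mu.-integrable `[0%R, 1%R] (EFin \o f x).
  by move=> _; exact: integrable01.
have derf (x s : R) : `]t - 1, t + 1[%classic x -> `[0%R, 1%R]%classic s -> derivable
  (f^~ s) x 1.
  by move=> _ _; exact: (@ex_derive _ _ _ _ _ _ _ (dfE x s)).
have G0 s : 0 <= G s by rewrite mulr_ge0 ?expR_ge0 // mulr_ge0 // addr_ge0.
have Gub (x s : R) : `]t - 1, t + 1[%classic x -> `[0%R, 1%R]%classic s ->
  `|partial1of2 f x s| <= G s.
  rewrite /= in_itv /= => /andP[x1 x2] _.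
  rewrite partial1of2E (@derive_val _ _ _ _ _ _ _ (dfE x s)).
  apply: le_trans (dfb x s) _; rewrite ler_wpM2r //.
  rewrite ler_expR ler_wpM2r // ler_norml; have := ler_norm t; have := ler_norm (- t).
  by rewrite normrN; lra.
have m01 : measurable (`[0%R, 1%R]%classic : set R) by exact: measurable_itv.
have ex := @derivable_under_integral R _ _ mu f _ m01 t _ _ It intf derf G G0
  (integrable01 cG) Gub.
have va := @differentiation_under_integral R _ _ mu f _ m01 t _ _ It intf derf G G0
  (integrable01 cG) Gub.
apply: DeriveDef; first exact: ex.
rewrite -derive1E [LHS]va; apply: eq_Rintegral => s _.
by rewrite partial1of2E (@derive_val _ _ _ _ _ _ _ (dfE t s)).
Qed.

Lemma cderiv_cint_exp (g phi : R -> R[i]) (t : R) : cont01 g -> cont01 phi ->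
  cderiv (fun x : R => cint (fun s => phi s * cexp (- (x%:C * g s)))) t
    (cint (fun s => - (g s * phi s) * cexp (- (t%:C * g s)))).
Proof.
move=> [gr gi] [pr pi].
have npr : cont (fun s => - complex.Re (phi s)) by move=> s; apply: cvgN; exact: pr.
have E (p z : R[i]) (x : R) : p * cexp (- (x%:C * z)) =
   (expR (- (x * complex.Re z)) * (complex.Re p * cos (x * complex.Im z) + complex.Im
     p * sin (x * complex.Im z)))
   +i* (expR (- (x * complex.Re z)) * (complex.Im p * cos (x * complex.Im z) + -
     complex.Re p * sin (x * complex.Im z))).
  case: p z => a b [c d]; apply: complex_ReIm;
    rewrite /= !mul0r !addr0 !subr0 cosN sinN; ring.
split.
  have := is_derive_int_exp_trig t gr gi pr pi.
  rewrite /cint /=; congr (is_derive _ _ _ _).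
    by apply/funext => x; apply: eq_Rintegral => s _; rewrite E.
  apply: eq_Rintegral => s _; rewrite E.
  by case: (g s) (phi s) => a b [c d] /=; ring.
have := is_derive_int_exp_trig t gr gi pi npr.
rewrite /cint /=; congr (is_derive _ _ _ _).
  by apply/funext => x; apply: eq_Rintegral => s _; rewrite E.
apply: eq_Rintegral => s _; rewrite E.
by case: (g s) (phi s) => a b [c d] /=; ring.
Qed.

End under_integral.

(** * Reality of the moments and independence of the loop *)

Section complex_ode.
Local Open Scope classical_set_scope.
Local Open Scope complex_scope.
Variable R : realType.
Implicit Types h : R -> R[i].

Lemma cderivZ z h t d : cderiv h t d -> cderiv (fun u => z * h u) t (z * d).
Proof.
move=> hd; apply: cderiv_eq (cderivM (cderiv_cst z t) hd) _.
by rewrite mul0r addr0.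
Qed.

Lemma cderiv_Re h t d : cderiv h t d ->
  cderiv (fun u => (complex.Re (h u))%:C) t (complex.Re d)%:C.
Proof. by move=> [hr _]; split => //=; exact: is_derive_cst. Qed.

(** As k is real, the components satisfy the equation separately. *)
Lemma complex_linear_ode_unique h (k : R) :
  (forall t, cderiv h t (k%:C * h t)) -> h 0 = 0 -> forall t, h t = 0.
Proof.
move=> dh h0 t; apply: complex_ReIm.
  apply: (@linear_ode_unique _ (fun u => complex.Re (h u)) k) => [u|];
    last by rewrite h0.
  apply: is_derive_eq (dh u).1 _.
  by rewrite complexReM /= mul0r subr0.
apply: (@linear_ode_unique _ (fun u => complex.Im (h u)) k) => [u|]; last by rewrite h0.
apply: is_derive_eq (dh u).2 _.
by rewrite complexImM /= mul0r addr0.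
Qed.

End complex_ode.

Section weights.
Local Open Scope classical_set_scope.
Local Open Scope complex_scope.
Variables (R : realType) (a : nat -> R).
Implicit Types (w : R[i] -> R[i]) (g : R -> R[i]).

Lemma eq_moment w w' g n q : w =1 w' -> moment a w g n q = moment a w' g n q.
Proof. by move=> /funext ->. Qed.

Section loop.
Variables (n : nat) (g : R -> R[i]).
Hypothesis g_adm : admissible_loop a n g.

Lemma cont_on_w_alpha alpha t : cont_on g (w_alpha alpha t).
Proof.
apply: cont01_prod => i _; apply: cont01D (cont01_cst _) _.
rewrite (funext (fun s => esym (mulN1r ((alpha i)%:C * g s)))).
by do 2 apply: cont01M (cont01_cst _) _; exact: cont_on_id g_adm.
Qed.

Lemma cont01_wplancherel_arg (tau : R) : cont01 (fun s => - (tau%:C * g s)).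
Proof.
rewrite (funext (fun s => esym (mulN1r (tau%:C * g s)))).
by do 2 apply: cont01M (cont01_cst _) _; exact: cont_on_id g_adm.
Qed.

Lemma cont_on_w_plancherel tau : cont_on g (w_plancherel tau).
Proof. by apply: cont01_cexp; exact: cont01_wplancherel_arg. Qed.

Lemma w_plancherel0 z : w_plancherel (0 : R) z = 1.
Proof.
by rewrite /w_plancherel /cexp mul0r oppr0 /= expR0 cos0 sin0 mulr1 mulr0.
Qed.

Lemma moment_w_alphaS alpha t m q : (m <= n)%N ->
  moment a (w_alpha alpha t.+1) g m q =
  moment a (w_alpha alpha t) g m q -
    (alpha t.+1)%:C * moment a (w_alpha alpha t) g m (q + 1).
Proof.
move=> mn; apply: (moment_comb g_adm) => // [|s _]; first exact: cont_on_w_alpha.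
by rewrite /w_alpha big_nat_recr //= mulrA.
Qed.

Lemma moment_plancherel_flow m q t : (m <= n)%N ->
  cderiv (fun u => moment a (w_plancherel u) g m q) t
    (- moment a (w_plancherel t) g m (q + 1)).
Proof.
move=> mn; pose phi s := g s ^ q * kern a m (g s) * path_deriv g s.
have cphi : cont01 phi.
  apply: cont01M (cont01_path_deriv (loop_C1 g_adm)).
  by apply: cont01M; [exact: cont_on_expz g_adm _ | exact: cont_on_kern g_adm _ mn].
have d := cderivZ (- twopii^-1) (cderiv_cint_exp t (cont_on_id g_adm) cphi).
rewrite (_ : (fun u => _) = fun u : R => - twopii^-1 *
    cint (fun s => phi s * cexp (- (u%:C * g s)))); last first.
  apply/funext => u; rewrite /moment mulNr; congr (- (_ * _)).
  by apply: eq_cint => s _; rewrite /phi /w_plancherel; ring.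
apply: cderiv_eq d _; rewrite /moment opprK mulNr -mulrN; congr (_ * _).
rewrite -[LHS]mulN1r -cintZ; last first.
  apply: cont01M; last by apply: cont01_cexp; exact: cont01_wplancherel_arg.
  rewrite (funext (fun s => esym (mulN1r (g s * phi s)))).
  by apply: cont01M (cont01_cst _) _; apply: cont01M cphi; exact: cont_on_id g_adm.
apply: eq_cint => s s01; rewrite /phi /w_plancherel expfzDr ?(loop_neq0 g_adm) //.
by rewrite expr1z; ring.
Qed.

(** The derivative of z^p exp(- tau z) is
(p z^(p-1) - tau z^p) exp(- tau z), which gives an induction on p. *)
Lemma moment_plancherel_exact (p : nat) tau : tau != 0 ->
  moment a (w_plancherel tau) g 0 p%:Z = 0.
Proof.
move=> t0; have tc : tau%:C != 0 :> R[i] by rewrite (inj_eq (@complexI R) _ 0).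
have C1 := loop_C1 g_adm.
have dw s : cderiv (fun t => cexp (- (tau%:C * g t))) s
    (cexp (- (tau%:C * g s)) * (- (tau%:C * path_deriv g s))).
  apply: cderiv_cexp; rewrite -mulN1r (funext (fun t => esym (mulN1r (tau%:C * g t)))).
  exact/cderivZ/cderivZ/cderiv_path.
rewrite /moment (_ : oint g _ = 0) ?mulr0 ?oppr0 //.
transitivity (oint g (fun z => z ^+ p * w_plancherel tau z)).
  by apply: eq_oint => s _; rewrite kern0 mul1r.
have cX k : cont_on g (fun z => z ^+ k * w_plancherel tau z).
  apply: cont01M; last exact: cont_on_w_plancherel.
  exact/cont01X/(cont_on_id g_adm).
have tN : - tau%:C != 0 :> R[i] by rewrite oppr_eq0.
elim: p => [|p IH]; apply: (mulfI tN); rewrite mulr0.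
  rewrite -ointZ //; apply: (oint_exact C1 (F := w_plancherel tau) (loop_closed g_adm)).
    exact: cont01M (cont01_cst _) (cX 0%N).
  by move=> s _; apply: cderiv_eq (dw s) _; rewrite /w_plancherel expr0; ring.
pose f z := p.+1%:R * (z ^+ p * w_plancherel tau z) + (- tau%:C) * (z ^+ p.+1 *
  w_plancherel tau z).
have cZ c k : cont_on g (fun z => c * (z ^+ k * w_plancherel tau z)).
  exact: cont01M (cont01_cst _) (cX k).
have f0 : oint g f = 0.
  apply: (oint_exact C1 (F := fun z => z ^+ p.+1 * w_plancherel tau z) (loop_closed
    g_adm)).
    exact: cont01D (cZ _ _) (cZ _ _).
  move=> s _; apply: cderiv_eq (cderivM (cderivX p (cderiv_path C1 s)) (dw s)) _.
  by rewrite /f /w_plancherel; ring.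
by move: f0; rewrite /f ointD // !ointZ // IH mulr0 add0r.
Qed.

(** For negative orders, the flow says that the moment of order - (j + 1) has
derivative minus the moment of order - j; so these moments vanish one after the
other, starting from time 0 where the weight is 1. *)
Lemma moment_plancherel_level0 q tau : moment a (w_plancherel tau) g 0 q = 0.
Proof.
have at0 q' : moment a (w_plancherel 0) g 0 q' = 0.
  by rewrite (eq_moment _ _ _ w_plancherel0) (moment1_level0 g_adm).
have nonneg (p : nat) u : moment a (w_plancherel u) g 0 p%:Z = 0.
  by have [->|u0] := eqVneq u 0; [exact: at0 | exact: moment_plancherel_exact].
case: q => [p|p]; first exact: nonneg.
suff: forall j u, moment a (w_plancherel u) g 0 (- j%:Z) = 0 by move=> h;
  rewrite NegzE h.
elim=> [|j IH] u; first exact: (nonneg 0%N).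
apply: (@complex_linear_ode_unique _ (fun u => moment a (w_plancherel u) g 0 (-
  j.+1%:Z)) 0) => //.
move=> t; apply: cderiv_eq (moment_plancherel_flow _ _ (leq0n n)) _.
by rewrite (_ : - j.+1%:Z + 1 = - j%:Z) ?IH ?mul0r ?oppr0 //; lia.
Qed.

End loop.

(** The relation between levels determines level m + 1 from level m and the single
value at - 1, upwards and downwards. *)
Lemma moment1_unique n (mu nu : nat -> int -> R[i]) (k : nat -> R[i]) :
  (forall m, (m < n)%N -> k m != 0) ->
  (forall q, mu 0%N q = nu 0%N q) ->
  (forall m, (m < n)%N -> mu m.+1 (-1) = nu m.+1 (-1)) ->
  (forall m q, (m < n)%N -> mu m q = mu m.+1 q - k m * mu m.+1 (q + 1)) ->
  (forall m q, (m < n)%N -> nu m q = nu m.+1 q - k m * nu m.+1 (q + 1)) ->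
  forall m q, (m <= n)%N -> mu m q = nu m q.
Proof.
move=> k0 e0 e1 rmu rnu; elim=> [|m IH] q mn; first exact: e0.
have up p : (mu m.+1 p = nu m.+1 p) -> mu m.+1 (p + 1) = nu m.+1 (p + 1).
  move=> ep; have := rmu m p mn; rewrite (IH _ (ltnW mn)) (rnu m p mn) ep.
  by move=> /addrI /oppr_inj /(mulfI (k0 m mn)).
have down p : (mu m.+1 (p + 1) = nu m.+1 (p + 1)) -> mu m.+1 p = nu m.+1 p.
  move=> ep; have := rmu m p mn; rewrite (IH _ (ltnW mn)) (rnu m p mn) ep.
  by move=> /addIr.
have init := e1 m mn.
case: q => [p|p].
  elim: p => [|p IHp]; first exact: (up (-1)).
  by rewrite (_ : Posz p.+1 = Posz p + 1); [exact: up | lia].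
elim: p => [|p IHp]; first exact: init.
by apply: down; rewrite (_ : Negz p.+1 + 1 = Negz p) // !NegzE; lia.
Qed.

Lemma complexReB_scale (x y : R[i]) (k : R) :
  complex.Re (x - k%:C * y) = complex.Re x - k * complex.Re y.
Proof. by case: x y => b c [d e] /=; rewrite mul0r subr0. Qed.

(** This eliminates the moments of order q + 1 from the flow by means of the
relation between levels; the result is a linear equation for the difference of two
families of moments that agree on the previous level. *)
Lemma level_gap (x y u v : R[i]) (k : R) : k != 0 ->
  x - k^-1%:C * u = (complex.Re y - k^-1 * complex.Re v)%:C ->
  - u + -1 * (complex.Re (- v))%:C = (- k)%:C * (x - (complex.Re y)%:C).
Proof.
case: y v => [y y'] [v v'] /= k0 e.
have kk : k%:C * k^-1%:C = 1 :> R[i] by rewrite -rmorphM mulfV.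
have -> : x - y%:C = k^-1%:C * (u - v%:C).
  rewrite -[x](subrK (k^-1%:C * u)) e rmorphB rmorphM; ring.
transitivity (- (k%:C * k^-1%:C) * (u - v%:C)); last first.
  by rewrite (rmorphN (real_complex R)); ring.
by rewrite kk (rmorphN (real_complex R)); ring.
Qed.

Section two_loops.
Variables (N : nat) (g0 : R -> R[i]).
Hypothesis a_neq0 : forall l, (1 <= l <= N)%N -> a l != 0.
Hypothesis g0_adm : admissible_loop a N g0.

Lemma real_level w m q : (m < N)%N -> cont_on g0 w ->
  complex.Re (moment a w g0 m q) =
  twist (a m.+1)^-1 (fun q => complex.Re (moment a w g0 m.+1 q)) q.
Proof.
move=> mN wc; rewrite (moment_level g0_adm q mN (@a_neq0 m.+1 mN) wc).
by rewrite complexReB_scale.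
Qed.

(** The real parts of the moments of one loop g0 satisfy the recursion of
[moment1_unique] as well; comparing them with the moments of another loop g yields
reality and independence of the loop at once. *)
Lemma moment1_real n g m q : (n <= N)%N -> admissible_loop a n g -> (m <= n)%N ->
  moment a (fun=> 1) g m q = (complex.Re (moment a (fun=> 1) g0 m q))%:C.
Proof.
move=> nN g_adm mn.
pose nu m q : R[i] := (complex.Re (moment a (fun=> 1) g0 m q))%:C.
have aN l : (l < n)%N -> a l.+1 != 0 by move=> ln; apply: a_neq0; lia.
apply: (@moment1_unique n (moment a (fun=> 1) g) nu (fun l => ((a l.+1)^-1)%:C)) => //.
- by move=> l ln; rewrite (inj_eq (@complexI R) _ 0) invr_neq0 // aN.
- by move=> p; rewrite /nu (moment1_level0 g_adm) (moment1_level0 g0_adm).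
- move=> l ln; rewrite /nu (moment1_init g_adm) ?(moment1_init g0_adm) //; first by lia.
  by move=> k kn; apply: a_neq0; lia.
- by move=> l p ln; apply: (moment_level g_adm) => //; [exact: aN | exact: cont01_cst].
- move=> l p ln; rewrite /nu real_level //; [|lia|exact: cont01_cst].
  by rewrite /twist rmorphB rmorphM.
Qed.

(** If level m agrees, the difference h at level m + 1 satisfies
h' = - a_(m+1) h, and it vanishes at time 0 by [moment1_real]. *)
Lemma moment_plancherel_real n g m q tau :
  (n <= N)%N -> admissible_loop a n g -> (m <= n)%N ->
  moment a (w_plancherel tau) g m q =
  (complex.Re (moment a (w_plancherel tau) g0 m q))%:C.
Proof.
move=> nN g_adm; elim: m q tau => [|m IH] q tau mn.
  by rewrite (moment_plancherel_level0 g_adm) (moment_plancherel_level0 g0_adm).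
have am : a m.+1 != 0 by apply: a_neq0; lia.
pose h u := moment a (w_plancherel u) g m.+1 q -
   (complex.Re (moment a (w_plancherel u) g0 m.+1 q))%:C.
suff h0 : h tau = 0 by apply/eqP; rewrite -subr_eq0 -/(h tau) h0.
apply: (@complex_linear_ode_unique _ h (- a m.+1)) => [t|]; last first.
  by rewrite /h !(eq_moment _ _ _ w_plancherel0) (moment1_real _ nN g_adm mn) subrr.
have d1 := moment_plancherel_flow g_adm q t mn.
have d2 := cderiv_Re (moment_plancherel_flow g0_adm q t (leq_trans mn nN)).
have := cderivD d1 (cderivZ (-1) d2).
rewrite (_ : (fun u => _) = h); last by apply/funext => u; rewrite mulN1r.
move/cderiv_eq; apply.
have := IH q t (ltnW mn).
rewrite (moment_level g_adm q mn am (cont_on_w_plancherel g_adm t)).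
rewrite (real_level q (leq_trans mn nN) (cont_on_w_plancherel g0_adm t)).
exact: level_gap am.
Qed.

End two_loops.
End weights.

(** * Iterated integrals as Toeplitz determinants *)

Lemma mkseqS_cons (T : Type) (f : nat -> T) r :
  mkseq f r.+1 = f 0%N :: mkseq (f \o S) r.
Proof. by rewrite /mkseq /= -(addn0 1%N) iotaDl -map_comp. Qed.

Section iterated_integrals.
Local Open Scope classical_set_scope.
Local Open Scope complex_scope.
Variable R : realType.
Implicit Types gs : nat -> R -> R[i].

Lemma eq_iter_oint r gs (F G : seq R[i] -> R[i]) :
  (forall zs, size zs = r ->
     (forall k, (k < r)%N -> exists2 s : R, 0 <= s <= 1 & zs`_k = gs k s) ->
     F zs = G zs) ->
  iter_oint (mkseq gs r) F = iter_oint (mkseq gs r) G.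
Proof.
elim: r gs F G => [|r IH] gs F G FG; first exact: FG.
rewrite mkseqS_cons /=; apply: eq_oint => s s01.
apply: IH => zs szs zsg; apply: FG => [|[|k] kr] /=; first by rewrite szs.
  by exists s.
exact: zsg.
Qed.

Lemma iter_oint_sum_prod (I : Type) (t : seq I) r gs (coef : I -> R[i])
    (phi : I -> nat -> R[i] -> R[i]) :
  (forall k, (k < r)%N -> C1_path (gs k)) ->
  (forall i k, (k < r)%N -> cont_on (gs k) (phi i k)) ->
  iter_oint (mkseq gs r) (fun zs => \sum_(i <- t) coef i * \prod_(k < r) phi i k
    zs`_k) =
  \sum_(i <- t) coef i * \prod_(k < r) oint (gs k) (phi i k).
Proof.
elim: r gs coef phi => [|r IH] gs coef phi gC1 pc.
  by rewrite /=; apply: eq_bigr => i _; rewrite !big_ord0.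
rewrite mkseqS_cons /=.
transitivity (oint (gs 0%N) (fun z => \sum_(i <- t)
   (coef i * \prod_(k < r) oint (gs k.+1) (phi i k.+1)) * phi i 0%N z)).
  apply: eq_oint => s s01.
  have IH' := IH (gs \o S) (fun i => coef i * phi i 0%N (gs 0%N s)) (fun i k => phi i
    k.+1).
  transitivity (\sum_(i <- t) coef i * phi i 0%N (gs 0%N s) * \prod_(k < r) oint (gs
    k.+1) (phi i k.+1)).
    rewrite -[RHS]IH' => [|k kr|i k kr]; [|exact: gC1|exact: pc].
    congr (iter_oint _ _); apply/funext => zs; apply: eq_bigr => i _.
    by rewrite big_ord_recl mulrA.
  by apply: eq_bigr => i _; rewrite mulrAC.
rewrite oint_sum; last first.
- by move=> i; apply: cont01M (cont01_cst _) _; exact: pc.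
- exact: gC1.
apply: eq_bigr => i _; rewrite ointZ; [|exact: gC1|exact: pc].
by rewrite big_ord_recl mulrCA mulrC mulrA mulrAC.
Qed.

End iterated_integrals.

Section andreief.
Local Open Scope classical_set_scope.
Local Open Scope complex_scope.
Variable F : fieldType.

Lemma prod_pairs r (z : 'I_r -> F) :
  \prod_(k < r) \prod_(l < r | (k < l)%N) (z k * z l) = \prod_(k < r) z k ^+ r.-1.
Proof.
under eq_bigr do rewrite big_split; rewrite big_split /=.
rewrite [X in _ * X](exchange_big_dep predT) //= -big_split /=.
apply: eq_bigr => k _.
transitivity (\prod_(l < r | l != k) z k); last by rewrite prodr_const cardC1 card_ord.
rewrite [RHS](bigID (fun l : 'I_r => (k < l)%N)) /=; congr (_ * _); apply: eq_bigl => l.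
  by rewrite -val_eqE /=; case: ltngtP.
by rewrite -val_eqE /=; case: ltngtP.
Qed.

Lemma sign_pairs r :
  (-1) ^+ (r * r.+1 %/ 2) * \prod_(k < r) \prod_(l < r | (k < l)%N) (-1) = (-1) ^+ r
    :> F.
Proof.
elim: r => [|r IH]; first by rewrite big_ord0 mulr1.
rewrite big_ord_recl.
have -> : \prod_(l < r.+1 | ((ord0 : 'I_r.+1) < l)%N) (-1) = (-1) ^+ r :> F.
   by rewrite big_mkcond big_ord_recl /= mul1r prodr_const card_ord.
have -> : \prod_(k < r) \prod_(l < r.+1 | (lift (ord0 : 'I_r.+1) k < l)%N) (-1) =
    \prod_(k < r) \prod_(l < r | (k < l)%N) (-1) :> F.
  apply: eq_bigr => k _; rewrite big_mkcond big_ord_recl /= mul1r [RHS]big_mkcond.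
  by apply: eq_bigr => l _; rewrite !bump0.
have -> : (r.+1 * r.+2 %/ 2 = r.+1 + r * r.+1 %/ 2)%N.
  have -> : (r.+1 * r.+2 = r.+1 * 2 + r * r.+1)%N by lia.
  by rewrite divnMDl.
by rewrite exprD mulrACA IH -mulrA -expr2 sqrr_sign mulr1.
Qed.

(** (z_k - z_l)^2 = - z_k z_l (z_l - z_k) (1 / z_l - 1 / z_k).  Taking one of the
two Vandermonde determinants in the inverses makes the exponents differences, so
that Toeplitz instead of Hankel determinants come out. *)
Lemma vandermonde_square r (z : 'I_r -> F) : (forall k, z k != 0) ->
  (-1) ^+ (r * r.+1 %/ 2) * \prod_(k < r) \prod_(l < r | (k < l)%N) (z k - z l) ^+ 2 =
  (-1) ^+ r * (\prod_(k < r) z k ^+ r.-1) *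
  (\det (Vandermonde r (\row_k z k)) * \det (Vandermonde r (\row_k (z k)^-1))).
Proof.
move=> z0; rewrite !det_Vandermonde -prod_pairs -(sign_pairs r) -!mulrA; congr (_ * _).
transitivity (\prod_(k < r) \prod_(l < r | (k < l)%N)
    (-1 * (z k * z l * ((z l - z k) * ((z l)^-1 - (z k)^-1))))).
  by apply: eq_bigr => k _; apply: eq_bigr => l kl; field; rewrite !z0.
under eq_bigr do rewrite !big_split; rewrite !big_split /=.
congr (_ * (_ * _)).
  by under [RHS]eq_bigr do rewrite big_split; rewrite big_split.
by congr (_ * _); apply: eq_bigr => k _; apply: eq_bigr => l _; rewrite !mxE.
Qed.

Lemma det_Vandermonde_tr r (z : 'I_r -> F) :
  \det (Vandermonde r (\row_k z k)) =
  \sum_(s : 'S_r) (-1) ^+ s * \prod_(k < r) z k ^+ s k.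
Proof.
rewrite -det_tr; apply: eq_bigr => s _; congr (_ * _).
by apply: eq_bigr => k _; rewrite !mxE.
Qed.

(** For fixed s the sum over p is the determinant with its rows permuted
by s. *)
Lemma double_det_sum r (f : nat -> nat -> F) :
  \sum_(s : 'S_r) \sum_(p : 'S_r)
    ((-1) ^+ s * (-1) ^+ p) * \prod_(k < r) f (s k) (p k) =
  r`!%:R * minor r f.
Proof.
transitivity (\sum_(s : 'S_r) minor r f).
  apply: eq_bigr => s _; rewrite /minor.
  set M := (\matrix_(i, j) _).
  transitivity ((-1) ^+ s * \det (row_perm s M)).
    rewrite mulr_sumr; apply: eq_bigr => p _; rewrite mulrA; congr (_ * _).
    by apply: eq_bigr => k _; rewrite !mxE.
  by rewrite row_permE det_mulmx det_perm mulrA -expr2 sqrr_sign mul1r.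
by rewrite sumr_const card_Sn mulr_natl.
Qed.

End andreief.

Section lln.
Local Open Scope classical_set_scope.
Local Open Scope complex_scope.
Variables (R : realType) (a : nat -> R) (w : R[i] -> R[i]) (n r : nat).
Variables (gs : nat -> R -> R[i]) (c : int -> R[i]).
Hypothesis gs_adm : forall k, (k < r)%N -> admissible_loop a n (gs k).
Hypothesis w_cont : forall k, (k < r)%N -> cont_on (gs k) w.
Hypothesis c_moment : forall k q, (k < r)%N -> moment a w (gs k) n q = c q.

Let expo (sp : 'S_r * 'S_r) (k : nat) : int :=
  if insub k is Some i then (sp.1 i : nat)%:Z - (sp.2 i : nat)%:Z - 1 else 0.

Let coef (sp : 'S_r * 'S_r) : R[i] :=
  (-1) ^+ r / (twopii ^+ r * r`!%:R) * ((-1) ^+ sp.1 * (-1) ^+ sp.2).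

Lemma expoE sp (i : 'I_r) : expo sp i = (sp.1 i : nat)%:Z - (sp.2 i : nat)%:Z - 1.
Proof. by rewrite /expo valK. Qed.

Lemma lln_integrand_expand zs : (forall k : 'I_r, zs`_k != 0) ->
  lln_integrand a w n r zs = \sum_(sp : 'S_r * 'S_r) coef sp *
    \prod_(k < r) (zs`_k ^ expo sp k * (kern a n zs`_k * w zs`_k)).
Proof.
move=> z0; have vs := vandermonde_square z0.
rewrite /lln_integrand vs.
transitivity ((-1) ^+ r / (twopii ^+ r * r`!%:R) *
   ((\sum_(s : 'S_r) (-1) ^+ s * \prod_(k < r) zs`_k ^+ s k) *
    (\sum_(s : 'S_r) (-1) ^+ s * \prod_(k < r) (zs`_k)^-1 ^+ s k)) *
   (\prod_(k < r) (zs`_k)^-1 * \prod_(k < r) (kern a n zs`_k * w zs`_k))).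
  rewrite -!det_Vandermonde_tr.
  rewrite (_ : \prod_(k < r) zs`_k ^+ r = (\prod_(k < r) zs`_k ^+ r.-1) * \prod_(k <
    r) zs`_k); last first.
    by rewrite -big_split /=; apply: eq_bigr => k _; case: r k => [[]|m] // k;
      rewrite exprSr.
  have p0 : \prod_(k < r) zs`_k != 0 by apply/prodf_neq0 => k _.
  have p1 : \prod_(k < r) zs`_k ^+ r.-1 != 0 by apply/prodf_neq0 => k _;
    rewrite expf_neq0.
  have t0 : twopii ^+ r != 0 :> R[i] by rewrite expf_neq0 // twopii_neq0.
  have f0 : r`!%:R != 0 :> R[i] by rewrite pnatr_eq0 -lt0n fact_gt0.
  rewrite prodfV; move: p0 p1 t0 f0.
  move: (\prod_(k < r) zs`_k) (\prod_(k < r) zs`_k ^+ r.-1) (twopii ^+ r) (r`!%:R :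
    R[i]).
  move: (\det _) (\det _) => v1 v2 x1 x2 x3 x4 p0 p1 t0 f0.
  rewrite -/(kern a n _).
  move: ((-1) ^+ r) => x5.
  rewrite [X in _ = _ * (_ * X)](_ : _ = \prod_(k < r) ((\prod_(1 <= l < n.+1)
     ((a l)%:C / ((a l)%:C - zs`_k))) * w zs`_k)) //.
  move: (\prod_(k < r) _) => x6; field; by rewrite p0 p1 t0 f0.
rewrite big_distrlr /= pair_bigA mulr_sumr mulr_suml; apply: eq_bigr => -[s p] _.
rewrite /coef /=.
transitivity ((-1) ^+ r / (twopii ^+ r * r`!%:R) * ((-1) ^+ s * (-1) ^+ p) *
  ((\prod_(k < r) zs`_k ^+ s k * \prod_(k < r) (zs`_k)^-1 ^+ p k) *
   (\prod_(k < r) (zs`_k)^-1 * \prod_(k < r) (kern a n zs`_k * w zs`_k)))).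
  move: (\prod_(k < r) _) (\prod_(k < r) _) (\prod_(k < r) _) (\prod_(k < r) _) => x1
    x2 x3 x4.
  move: ((-1) ^+ s) ((-1) ^+ p) (_ / _) => y1 y2 y3; ring.
congr (_ * _); rewrite -!big_split /=; apply: eq_bigr => k _; rewrite expoE /=.
rewrite !expfzDr // exprN1 -exprnN exprVn -exprnP; ring.
Qed.

(** On the loops the integrand is a finite sum of products of functions of one
variable each, so the iterated integral is the same sum of products of moments,
which [double_det_sum] recognizes. *)
Lemma lln_integral : iter_oint (mkseq gs r) (lln_integrand a w n r) = toeplitz c (-1) r.
Proof.
pose phi sp k z := z ^ expo sp k * (kern a n z * w z).
transitivity (iter_oint (mkseq gs r)
   (fun zs => \sum_(sp : 'S_r * 'S_r) coef sp * \prod_(k < r) phi sp k zs`_k)).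
  apply: eq_iter_oint => zs szs zsg; apply: lln_integrand_expand => k.
  by have [s s01 ->] := zsg k (ltn_ord k); exact: loop_neq0 (gs_adm (ltn_ord k)) _ s01.
have phi_cont sp k : (k < r)%N -> cont_on (gs k) (phi sp k).
  by move=> kr; exact: (cont_on_moment (gs_adm kr) (expo sp k) (leqnn n) (w_cont kr)).
rewrite iter_oint_sum_prod => [|k kr|sp k kr];
  [|exact: loop_C1 (gs_adm kr)|exact: phi_cont].
have t0 : twopii != 0 :> R[i] := @twopii_neq0 R.
have int_phi sp (k : 'I_r) : oint (gs k) (phi sp k) = - twopii * c (-1 + (sp.1 k :
  nat)%:Z - (sp.2 k : nat)%:Z).
  rewrite -(c_moment _ (ltn_ord k)) /moment mulrNN mulVKf //; congr (oint _ _).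
  by apply/funext => z; rewrite /phi expoE; congr (z ^ _ * _); lia.
have f0 : r`!%:R != 0 :> R[i] by rewrite pnatr_eq0 -lt0n fact_gt0.
apply: (mulfI f0); rewrite -double_det_sum pair_bigA /= mulr_sumr.
apply: eq_bigr => -[s p] _; rewrite /coef /=.
under eq_bigr do rewrite int_phi /=.
rewrite big_split /= prodr_const card_ord (exprNn twopii).
move: (\prod_(i < r) _) => x.
have ss : (-1) ^+ r * (-1) ^+ r = 1 :> R[i] by rewrite -expr2 sqrr_sign.
transitivity (((-1) ^+ r * (-1) ^+ r) * ((-1) ^+ s * (-1) ^+ p * x));
  last by rewrite ss mul1r.
have tr : twopii ^+ r != 0 :> R[i] by rewrite expf_neq0.
move: (twopii ^+ r) tr (r`!%:R : R[i]) f0 => y1 n1 y2 n2.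
move: ((-1) ^+ r) ((-1) ^+ s) ((-1) ^+ p) => y3 y4 y5.
by field; rewrite n1 n2.
Qed.

End lln.

(** * The limits as quotients of determinants *)

Section tau_of_limits.
Local Open Scope complex_scope.
Variable R : realType.

Lemma toeplitz_real (c : int -> R) s r :
  toeplitz (fun q => (c q)%:C) s r = (toeplitz c s r)%:C.
Proof.
rewrite /toeplitz /minor -det_map_mx; congr (\det _).
by apply/matrixP => i j; rewrite !mxE.
Qed.

Lemma lln_tauD (N : nat) (a : nat -> R) w x (c : nat -> int -> R) :
  lln_limits N a w x ->
  (forall n g, (n <= N)%N -> admissible_loop a n g ->
     cont_on g w /\ forall q, moment a w g n q = (c n q)%:C) ->
  forall n r, (r <= n)%N -> (n <= N)%N ->
  tauD (c n) r = expR (- \sum_((n - r).+1 <= k < n.+1) x n k).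
Proof.
move=> lim cm n [|r] rn nN.
  by rewrite tau0 subn0 big_geq // oppr0 expR0.
have [gs [gs_adm e]] := lim n r.+1 isT rn nN.
apply/(@complexI R); rewrite e -toeplitz_real; symmetry.
apply: lln_integral (gs_adm) _ _ => [k kr|k q kr].
  by have [] := cm n _ nN (gs_adm k kr).
by have [_ ->] := cm n _ nN (gs_adm k kr).
Qed.

(** The telescoping quotient also covers both boundary conventions, k = 0 because
D_(n+1) = 0, and k = n + 1 by the value of [yratio] at 0. *)
Lemma y_of_yratio (x : nat -> nat -> R) n (D : nat -> R) :
  D n.+1 = 0 ->
  (forall r, (r <= n)%N -> D r = expR (- \sum_((n - r).+1 <= k < n.+1) x n k)) ->
  forall k, (k <= n.+1)%N -> y_of x n k = yratio D (n.+1 - k).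
Proof.
move=> Dtop De [|k] kn; rewrite /y_of /=; first by rewrite Dtop mul0r.
rewrite subSS; case: ltnP => nk.
  by rewrite (_ : (n - k)%N = 0%N) //; lia.
rewrite (_ : (n - k)%N = (n - k.+1).+1); last by lia.
rewrite /= !De; [|by lia..].
rewrite (_ : (n - (n - k.+1).+1).+1 = k.+1); last by lia.
rewrite (_ : (n - (n - k.+1)).+1 = k.+2); last by lia.
rewrite big_ltn; last by lia.
by rewrite opprD expRD mulfK // gt_eqF // expR_gt0.
Qed.

(** The conventions for X and y correspond to each other under y = exp(- X). *)
Lemma exp_diff_y_of (x : nat -> nat -> R) n k n' k' :
  exp_diff (x_ext x n k.+1) (x_ext x n' k') = y_of x n' k' / y_of x n k.+1.
Proof.
rewrite /exp_diff /x_ext /y_of /=.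
case: (k' == 0%N).
  by case: (n < k.+1)%N => /=; rewrite mul0r.
case: (n < k.+1)%N; case: (n' < k')%N; rewrite /= -?EFinB /= ?subrr ?expR0 ?divr1 //.
- by rewrite sub0r.
- by rewrite subr0 div1r expRN invrK.
- by rewrite -expRN opprK -expRD addrC.
Qed.

(** One twist for each factor 1 - alpha_i z of the weight. *)
Fixpoint alpha_moment (alpha : nat -> R) (c : nat -> int -> R) t n : int -> R :=
  if t is t'.+1 then twist (alpha t) (alpha_moment alpha c t' n) else c n.

Lemma twist_comm k l (c : int -> R) : twist k (twist l c) = twist l (twist k c).
Proof. by apply/funext => q; rewrite /twist; ring. Qed.

Lemma alpha_moment_level alpha (c : nat -> int -> R) k n t :
  c n = twist k (c n.+1) ->
  alpha_moment alpha c t n = twist k (alpha_moment alpha c t n.+1).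
Proof. by move=> cn; elim: t => //= t ->; exact: twist_comm. Qed.

Lemma alpha_moment_level0 alpha (c : nat -> int -> R) t q :
  (forall q, c 0%N q = 0) -> alpha_moment alpha c t 0 q = 0.
Proof. by move=> c0; elim: t q => //= t IH q; rewrite /twist !IH mulr0 subr0. Qed.

Lemma moment_alpha_real (N : nat) (a : nat -> R) g0 alpha t n g m q :
  (forall l, (1 <= l <= N)%N -> a l != 0) -> admissible_loop a N g0 ->
  (n <= N)%N -> admissible_loop a n g -> (m <= n)%N ->
  moment a (w_alpha alpha t) g m q =
  (alpha_moment alpha (fun n q => complex.Re (moment a (fun=> 1) g0 n q)) t m q)%:C.
Proof.
move=> a0 g0_adm nN g_adm mn; elim: t q => [|t IH] q.
  rewrite /= -(moment1_real a0 g0_adm q nN g_adm mn); apply: eq_moment => z.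
  by rewrite /w_alpha big_geq.
by rewrite (moment_w_alphaS g_adm) // !IH /= /twist rmorphB rmorphM.
Qed.

End tau_of_limits.

Theorem corollary3p5 (R : realType) (N : nat) (a : nat -> R)
    (N1 : (1 <= N)%N) (a_gt0 : forall i, (1 <= i <= N)%N -> 0 < a i) :
  (forall (alpha : nat -> R) (x : nat -> nat -> nat -> R),
     (forall j, (1 <= j)%N -> 0 < alpha j) ->
     (forall i j, (1 <= i <= N)%N -> (1 <= j)%N -> a i * alpha j < 1) ->
     (forall t, lln_limits N a (w_alpha alpha t) (x t)) ->
     let y t := y_of (x t) in
     forall k n t, (1 <= k)%N -> (k <= n)%N -> (n <= N)%N -> (1 <= t)%N ->
       1 - y t n k / y t n.-1 k != 0 ->
       1 - y t.-1 n k.-1 / y t n k != 0 ->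
       a n * ((1 - y t n.-1 k.-1 / y t n k) * (1 - y t n k / y t n k.+1)
              / (1 - y t n k / y t n.-1 k))
       = (alpha t)^-1 *
         ((1 - y t n k / y t.-1 n k) * (1 - y t n k.-1 / y t n k)
          / (1 - y t.-1 n k.-1 / y t n k)))
  /\
  (forall x : R -> nat -> nat -> R,
     (forall tau, 0 < tau -> lln_limits N a (w_plancherel tau) (x tau)) ->
     let X tau := x_ext (x tau) in
     forall k n (tau : R), (1 <= k)%N -> (k <= n)%N -> (n <= N)%N -> 0 < tau ->
       1 - exp_diff (X tau n.-1 k) (X tau n k) != 0 /\
       is_derive tau 1 (fun s : R => x s n k)
         (a n * ((1 - exp_diff (X tau n k) (X tau n.-1 k.-1))
                 * (1 - exp_diff (X tau n k.+1) (X tau n k))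
                 / (1 - exp_diff (X tau n.-1 k) (X tau n k))))).
Proof.
have a_neq0 l : (1 <= l <= N)%N -> a l != 0 by move=> lN; rewrite gt_eqF // a_gt0.
split.
- move=> alpha x alpha_gt0 _ lim y [|k] [|n] // t _ kn nN; case: t => // t _.
  have [gs [/(_ 0%N isT) g0_adm _]] := lim 0%N N 1%N isT N1 (leqnn N).
  set g0 := gs 0%N in g0_adm.
  pose base n q := complex.Re (moment a (fun=> 1) g0 n q).
  pose c := alpha_moment alpha base.
  have base0 q : base 0%N q = 0 by rewrite /base (moment1_level0 g0_adm).
  have c_level u m : (m < N)%N -> c u m = twist (a m.+1)^-1 (c u m.+1).
    move=> mN; apply: alpha_moment_level; apply/funext => q.
    exact: (real_level a_neq0 g0_adm q mN (cont01_cst 1)).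
  have De u m r : (r <= m)%N -> (m <= N)%N ->
      tauD (c u m) r = expR (- \sum_((m - r).+1 <= k < m.+1) x u m k).
    move=> rm mN; apply: (lln_tauD (c := c u) (lim u)) rm mN => l g lN g_adm; split.
      exact: cont_on_w_alpha g_adm _ _.
    by move=> q; exact: moment_alpha_real a_neq0 g0_adm lN g_adm (leqnn l).
  have Dtop u m : (m <= N)%N -> tauD (c u m) m.+1 = 0.
    move=> mN; apply: recurrent_toeplitz0.
    apply: (recurrent_levels (N := N) (c := c u)) mN => [q|l lN];
      last exact: c_level lN.
    exact: alpha_moment_level0.
  have D0 u m r : (r <= m)%N -> (m <= N)%N -> tauD (c u m) r != 0.
    by move=> rm mN; rewrite De // gt_eqF // expR_gt0.
  have yE u m l : (m <= N)%N -> (l <= m.+1)%N ->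
      y u m l = yratio (tauD (c u m)) (m.+1 - l).
    by move=> mN lm; apply: y_of_yratio lm => [|r rm]; [exact: Dtop | exact: De].
  pose m := (n - k)%N.
  have nN' : (n <= N)%N by exact: ltnW.
  rewrite /= !yE //; try lia.
  (* The y of index k + 1 at level n + 1 is D_(m + 1) / D_m, and so on. *)
  have -> : (n.+2 - k.+1 = m.+1)%N by rewrite /m; lia.
  have -> : (n.+1 - k.+1 = m)%N by rewrite /m; lia.
  have -> : (n.+2 - k.+2 = m)%N by rewrite /m; lia.
  have -> : (n.+2 - k = m.+2)%N by rewrite /m; lia.
  have -> : (n.+1 - k = m.+1)%N by rewrite /m; lia.
  have mn : (m <= n)%N by rewrite /m; lia.
  rewrite (c_level _ n nN) => den1 den2.
  have am : a n.+1 != 0 by apply: a_neq0.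
  rewrite level_speed //; try (by apply: D0; lia);
    try (by rewrite -c_level //; apply: D0; lia).
  symmetry; apply: (@time_speed _ (alpha t.+1) (c t n.+1) m) => //;
    try (by apply: D0; lia).
    by rewrite gt_eqF // alpha_gt0.
    exact: (D0 t.+1 n.+1 m (leqW mn) nN).
  exact: (D0 t.+1 n.+1 m.+1 mn nN).
- move=> x lim X [|k] [|n] // tau _ kn nN tau0.
  have [gs [/(_ 0%N isT) g0_adm _]] := lim 1 ltr01 N 1%N isT N1 (leqnn N).
  set g0 := gs 0%N in g0_adm.
  pose c n (u : R) q := complex.Re (moment a (w_plancherel u) g0 n q).
  have c_pos l : (l < N)%N -> 0 < a l.+1 by move=> lN; apply: a_gt0.
  have c0 u q : c 0%N u q = 0 by rewrite /c (moment_plancherel_level0 g0_adm).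
  have c_level l u : (l < N)%N -> c l u = twist (a l.+1)^-1 (c l.+1 u).
    move=> lN; apply/funext => q.
    exact: (real_level a_neq0 g0_adm q lN (cont_on_w_plancherel g0_adm u)).
  have c_flow l (u : R) q : (l <= N)%N ->
      is_derive u 1 (fun v => c l v q) (- c l u (q + 1)).
    move=> lN; have [d _] := moment_plancherel_flow g0_adm q u lN.
    by apply: is_derive_eq d _; rewrite /c; case: (moment _ _ _ _ _).
  have c_init l : (l < N)%N -> c l.+1 0 (-1) = 1.
    move=> lN; rewrite /c (eq_moment _ _ _ _ (@w_plancherel0 R)).
    by rewrite (moment1_init g0_adm).
  have De u m r : 0 < u -> (r <= m)%N -> (m <= N)%N ->
      tauD (c m u) r = expR (- \sum_((m - r).+1 <= k < m.+1) x u m k).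
    move=> u0 rm mN; apply: (lln_tauD (c := fun m => c m u) (lim u u0)) rm mN.
    move=> l g lN g_adm; split.
      exact: cont_on_w_plancherel g_adm _.
    by move=> q; rewrite (moment_plancherel_real a_neq0 g0_adm q u lN g_adm (leqnn l)).
  have D_gt0 m r u : (r <= m)%N -> (m <= N)%N -> 0 < u -> 0 < tauD (c m u) r.
    by move=> rm mN u0; rewrite De // expR_gt0.
  have yE u m l : 0 < u -> (m <= N)%N -> (l <= m.+1)%N ->
      y_of (x u) m l = yratio (tauD (c m u)) (m.+1 - l).
    move=> u0 mN lm; apply: y_of_yratio lm => [|r rm]; last exact: De.
    exact: (flow_tauD_top c0 c_level).
  pose m := (n - k)%N.
  have nN' : (n <= N)%N by exact: ltnW.
  have mn : (m <= n)%N by rewrite /m; lia.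
  rewrite /X /= !exp_diff_y_of !yE //; try lia.
  have -> : (n.+2 - k.+1 = m.+1)%N by rewrite /m; lia.
  have -> : (n.+1 - k.+1 = m)%N by rewrite /m; lia.
  have -> : (n.+2 - k.+2 = m)%N by rewrite /m; lia.
  have -> : (n.+1 - k = m.+1)%N by rewrite /m; lia.
  have den := flow_denominator_neq0 c_pos c0 c_level c_flow c_init D_gt0 mn nN tau0.
  split; first exact: den.
  have nz r u l : (r <= l)%N -> (l <= N)%N -> 0 < u -> tauD (c l u) r != 0.
    by move=> rl lN u0; rewrite gt_eqF // D_gt0.
  have am : a n.+1 != 0 by apply: a_neq0.
  have speed : a n.+1 *
      ((1 - yratio (tauD (c n tau)) m.+1 / yratio (tauD (c n.+1 tau)) m.+1) *
      (1 - yratio (tauD (c n.+1 tau)) m.+1 / yratio (tauD (c n.+1 tau)) m) /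
      (1 - yratio (tauD (c n.+1 tau)) m.+1 / yratio (tauD (c n tau)) m)) =
      tauF (c n.+1 tau) m.+1 * tauE (c n.+1 tau) m /
      (tauD (c n.+1 tau) m.+1 * tauD (c n.+1 tau) m).
    move: den; rewrite (c_level n tau nN) => den.
    rewrite level_speed //; try (by apply: nz => //; lia);
      by rewrite -c_level //; apply: nz => //; lia.
  rewrite speed.
  have dratio := flow_ratio_derive c_flow nN (nz m tau n.+1 (leqW mn) nN tau0).
  have ratio_gt0 : 0 < tauD (c n.+1 tau) m.+1 / tauD (c n.+1 tau) m.
    by rewrite divr_gt0 // D_gt0 //; lia.
  have dln := is_deriveN (@is_derive1_comp R (@ln R)
    (fun u => tauD (c n.+1 u) m.+1 / tauD (c n.+1 u) m) tau _ _
    (is_derive1_ln ratio_gt0) dratio).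
  apply: near_eq_is_derive; last first.
    apply: is_derive_eq dln _.
    by field; rewrite !nz //; lia.
  near=> u.
  have u0 : 0 < u by near: u; exact: (cvgr_gt tau (@cvg_id _ (nbhs tau)) 0 tau0).
  rewrite -[LHS]/(- ln (yratio (tauD (c n.+1 u)) m.+1)).
  have := yE u n.+1 k.+1 u0 nN; rewrite (_ : (n.+2 - k.+1 = m.+1)%N);
    last by rewrite /m; lia.
  move=> <-; last by lia.
  by rewrite /y_of /= ltnS ltnNge -ltnS kn /= expRK opprK.
Unshelve. all: by end_near.
Qed.
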